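(* Fix $\ell\in[1,\infty]$, and let $\mathcal H$ and $\hat{\mathcal H}$ be the nominal (surrogate) and target hybrid systems with inputs described in the context. Let $\mathbb D_{c,\ell}=\mathcal D_{c,\ell}\times\mathrm{id}_{\mathbb Z_{\ge0}}$ for all $c\in\mathbb R_{\ge1}$. Then the map $$\mathcal W:\ \mathcal S_{\hat{\mathcal H}}\longrightarrow\mathcal S_{\mathcal H},\qquad \big(\hat z=(\hat x,\hat\tau,\hat\mu),\hat u\big)\longmapsto\big(\hat z\circ\mathbb D_{\hat\mu(0,0),\ell},\ \hat u\circ\mathbb D_{\hat\mu(0,0),\ell}\big)$$ is a bijection. Moreover, for every $(\hat z,\hat u)\in\mathcal S_{\hat{\mathcal H}}$, the hybrid time domain of $\mathcal W(\hat z,\hat u)$ equals $\mathbb D_{\hat\mu(0,0),\ell}^{-1}(\mathrm{dom}(\hat z))$.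
   Context: **Gain and time dilation.** Fix $\Upsilon>0$. For $\mu\ge1$: $F_{\mu,1}(\mu)=\mu/\Upsilon$; $F_{\mu,\ell}(\mu)=\frac{\ell}{\ell-1}\frac{\mu^{2-1/\ell}}{\Upsilon}$ for $1<\ell<\infty$; $F_{\mu,\infty}(\mu)=\mu^2/\Upsilon$. For $c\ge1$: $T_{c,1}=\infty$, $T_{c,\ell}=\Upsilon c^{(1-\ell)/\ell}$ for $1<\ell<\infty$, $T_{c,\infty}=\Upsilon/c$. The diffeomorphism $\mathcal D_{c,\ell}:[0,T_{c,\ell})\to\mathbb R_{\ge0}$ is $\mathcal D_{c,1}(t)=\Upsilon(ce^{t/\Upsilon}-c)$; $\mathcal D_{c,\ell}(t)=(\ell-1)\Upsilon\big(\Upsilon^{\frac1{\ell-1}}(\Upsilon c^{\frac{1-\ell}{\ell}}-t)^{\frac1{1-\ell}}-c^{1/\ell}\big)$ for $1<\ell<\infty$; $\mathcal D_{c,\infty}(t)=\Upsilon\ln\frac{\Upsilon}{\Upsilon-ct}$. **Data.** $\phi:\mathbb R_{\ge0}\to\mathbb R^n$ is continuous and uniformly bounded. $\mathcal Q=\{1,\dots,\bar q\}=\mathcal Q_s\cup\mathcal Q_i\cup\mathcal Q_c$ with $\mathcal Q_s\cap(\mathcal Q_i\cup\mathcal Q_c)=\emptyset$. For $q\in\mathcal Q_s\cup\mathcal Q_i$: $\phi_{q,k}\in\mathbb R^n$ ($1\le k\le\bar k_q$) are recorded values of $\phi$ and $\Phi_q=\sum_{k=1}^{\bar k_q}\phi_{q,k}\phi_{q,k}^\top$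 (with $\Phi_q\succeq\alpha_qI$, $\alpha_q>0$, for $q\in\mathcal Q_s$, and only with $\alpha_q=0$ for $q\in\mathcal Q_i$); $\mathcal Q_c$ indexes corrupted datasets. $k_{\rm t},k_{\rm r}>0$. The input is $u=(u_1,u_2,u_3)\in\mathbb R^{n_u}$ with $u_1\in\mathbb R$, $u_2=(u_{2,q})_{q\in\mathcal Q_s\cup\mathcal Q_i}$, $u_{2,q}\in\mathbb R^{\bar k_q}$, and $u_3\in\mathbb R^n$. The error map is $$\mathcal E_q(\vartheta,\tau,u)=-\big(k_{\rm t}\phi(\tau)\phi(\tau)^\top+\mathbb I_{\mathcal Q_s\cup\mathcal Q_i}(q)\,k_{\rm r}\Phi_q\big)\vartheta+\eta_q(\tau,u),$$ where $\eta_q(\tau,u)=k_{\rm t}\phi(\tau)u_1+k_{\rm r}\sum_{k=1}^{\bar k_q}\phi_{q,k}(u_{2,q})_k$ if $q\in\mathcal Q_s\cup\mathcal Q_i$, and $\eta_q(\tau,u)=k_{\rm t}\phi(\tau)u_1+k_{\rm r}u_3$ if $q\in\mathcal Q_c$; $\mathbb I$ denotes the $\{0,1\}$-valued indicator. **Automaton.** $T_0>0$, $N_0\ge1$, $\tau_d>0$, $\tau_a>1$; $y=(q,\rho_d,\rho_a)$; $C_\sigma=\mathcal Q\times[0,N_0]\times[0,T_0]$, $F_\sigma(y)=\{0\}\times[0,\frac1{\tau_d}]\times\big([0,\frac1{\tau_a}]-\mathbb I_{\mathcal Q_i\cup\mathcal Q_c}(q)\big)$, $D_\sigma=\mathcal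 Q\times[1,N_0]\times[0,T_0]$, $G_\sigma(y)=(\mathcal Q\setminus\{q\})\times\{\rho_d-1\}\times\{\rho_a\}$. **Nominal system $\mathcal H$.** State $\tilde z=(\tilde x,\tau,\mu)$, $\tilde x=(\vartheta,y)\in\mathbb R^{n+3}$. Let $C_x=\mathbb R^n\times C_\sigma$, $D_x=\mathbb R^n\times D_\sigma$, $C_z=C_x\times\mathbb R_{\ge0}\times\mathbb R_{\ge1}$, $D_z=D_x\times\mathbb R_{\ge0}\times\mathbb R_{\ge1}$, $\tilde F_x(\tilde x,\tau,u)=\{\mathcal E_q(\vartheta,\tau,u)\}\times F_\sigma(y)$, $G(\tilde z)=\{\vartheta\}\times G_\sigma(y)\times\{\tau\}\times\{\mu\}$. Then $\mathcal H$ is: if $(\tilde z,u)\in C_z\times\mathbb R^{n_u}$, $\frac{d\tilde z}{dt}\in\mu\tilde F_x(\tilde x,\tau,u)\times\{1\}\times\{F_{\mu,\ell}(\mu)\}$; if $(\tilde z,u)\in D_z\times\mathbb R^{n_u}$, $\tilde z^+\in G(\tilde z)$. **Target system $\hat{\mathcal H}$.** State $\hat z=(\hat x,\hat\tau,\hat\mu)$, continuous time denoted $s$: if $(\hat z,\hat u)\in C_z\times\mathbb R^{n_u}$, $\frac{d\hat z}{ds}\in\tilde F_x(\hat x,\hat\tau,\hat u)\times\{\frac1{\hat\mu}\}\times\{\frac1{\hat\mu}F_{\mu,\ell}(\hat\mu)\}$; if $(\hat z,\hat u)\in D_z\times\mathbb R^{n_u}$, $\hat z^+\in G(\hat z)$.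 **Solutions.** Solution pairs (hybrid arc, hybrid input) of hybrid systems with inputs are in the usual sense (Goebel–Sanfelice–Teel; Sanfelice): the state is a hybrid arc and the input a hybrid input with the same hybrid time domain in $\mathbb R_{\ge0}\times\mathbb Z_{\ge0}$; hybrid inputs are Lebesgue measurable and locally essentially bounded in continuous time. A pair is maximal if it cannot be extended. $\mathcal S_{\mathcal H}$ and $\mathcal S_{\hat{\mathcal H}}$ are the sets of all maximal solution pairs. *)

(* Defs.v *)
From HB Require Import structures.
From mathcomp Require Import all_boot all_order all_algebra.
From mathcomp Require Import all_classical all_reals all_analysis.
From mathcomp Require Import measurable_realfun.
Import Order.TTheory GRing.Theory Num.Theory.
Import numFieldNormedType.Exports.

Set Implicit Arguments.
Unset Strict Implicit.
Unset Printing Implicit Defensive.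

Local Open Scope classical_set_scope.
Local Open Scope ring_scope.

Section HybridArcs.
Context {R : realType}.

Definition compact_htd (E : set (R * nat)) : Prop :=
  exists (J : nat) (t : nat -> R),
    [/\ t 0%N = 0, (forall j, (j < J)%N -> t j <= t j.+1)
      & E = [set p | (p.2 < J)%N /\ t p.2 <= p.1 <= t p.2.+1]].

Definition hybrid_time_domain (E : set (R * nat)) : Prop :=
  (forall p, E p -> 0 <= p.1) /\
  (forall p, E p ->
     compact_htd (E `&` [set r | 0 <= r.1 <= p.1 /\ (r.2 <= p.2)%N])).

(* A function on a hybrid time domain is encoded as a partial function, so   *)
(* that Leibniz equality is equality of domains and of values on the domain. *)
Definition hfun (X : Type) := (R * nat)%type -> option X.

Definition hdom X (f : hfun X) : set (R * nat) := [set p | f p <> None].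

(* I^j *)
Definition hslice X (f : hfun X) (j : nat) : set R :=
  [set t | hdom f (t, j)].

(* t |-> f (t, j), with junk value 0 outside I^j; all uses below only depend *)
(* on the values on I^j (derivatives are only constrained at almost every    *)
(* time of I^j, hence at interior points).                                   *)
Definition hval (X : nmodType) (f : hfun X) (j : nat) : R -> X :=
  fun t => odflt 0 (f (t, j)).

Definition abs_continuous (V : normedModType R) (a b : R) (f : R -> V) :=
  forall eps : R, 0 < eps -> exists2 delta : R, 0 < delta &
    forall (m : nat) (s t : 'I_m -> R),
      (forall k, [/\ a <= s k, s k <= t k & t k <= b]) ->
      trivIset setT (fun k => `]s k, t k[%classic) ->
      \sum_k (t k - s k) < delta ->
      \sum_k `|f (t k) - f (s k)| < eps.

(* "Locally" means on every compact subinterval of I. *)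
Definition loc_abs_continuous (V : normedModType R) (I : set R) (f : R -> V) :=
  forall a b : R, a <= b -> `[a, b]%classic `<=` I -> abs_continuous a b f.

Definition loc_ess_bounded (V : normedModType R) (I : set R) (f : R -> V) :=
  forall a b : R, a <= b -> `[a, b]%classic `<=` I ->
    exists M : R, {ae lebesgue_measure, forall t : R,
      t \in `[a, b] -> `|f t| <= M}.

(* [completed_algebra_gen lebesgue_measure] is the family of Lebesgue (not   *)
(* just Borel) measurable sets: unions of a Borel set and a negligible set.  *)
Definition lebesgue_measurable_on (V : normedModType R) (I : set R)
    (f : R -> V) :=
  forall O : set V, open O ->
    completed_algebra_gen (@lebesgue_measure R) (I `&` f @^-1` O).

Definition hybrid_arc (X : normedModType R) (z : hfun X) : Prop :=
  hybrid_time_domain (hdom z) /\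
  forall j, loc_abs_continuous (hslice z j) (hval z j).

Definition hybrid_input (U : normedModType R) (u : hfun U) : Prop :=
  hybrid_time_domain (hdom u) /\
  forall j, lebesgue_measurable_on (hslice u j) (hval u j) /\
            loc_ess_bounded (hslice u j) (hval u j).

End HybridArcs.
Arguments hfun : clear implicits.

Section HybridSystems.
Context {R : realType} {X U : normedModType R}.

Record hybrid_system := HybridSystem {
  flow_set : set (X * U) ;
  flow_map : X -> U -> set X ;
  jump_set : set (X * U) ;
  jump_map : X -> U -> set X }.

Record solution_pair (H : hybrid_system) (p : hfun R X * hfun R U) : Prop :=
  SolutionPair {
    sol_arc : hybrid_arc p.1 ;
    sol_input : hybrid_input p.2 ;
    sol_dom : hdom p.1 = hdom p.2 ;
    sol_init : hdom p.1 (0, 0%N) /\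
      (closure (flow_set H) `|` jump_set H) (hval p.1 0 0, hval p.2 0 0) ;
    sol_flow_set : forall j t, (hslice p.1 j)^° t ->
      flow_set H (hval p.1 j t, hval p.2 j t) ;
    sol_flow_map : forall j, (hslice p.1 j)^° !=set0 ->
      {ae lebesgue_measure, forall t : R, hslice p.1 j t ->
        exists2 v, flow_map H (hval p.1 j t) (hval p.2 j t) v
                 & is_derive t 1 (hval p.1 j) v} ;
    sol_jump : forall j t, hdom p.1 (t, j) -> hdom p.1 (t, j.+1) ->
      jump_set H (hval p.1 j t, hval p.2 j t) /\
      jump_map H (hval p.1 j t) (hval p.2 j t) (hval p.1 j.+1 t) }.

Definition extends (p p' : hfun R X * hfun R U) : Prop :=
  [/\ hdom p.1 `<` hdom p'.1,
      forall r, hdom p.1 r -> p'.1 r = p.1 r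
    & forall r, hdom p.2 r -> p'.2 r = p.2 r].

Definition maximal_solution_pairs (H : hybrid_system) :
    set (hfun R X * hfun R U) :=
  [set p | solution_pair H p /\
           ~ exists p', solution_pair H p' /\ extends p p'].

End HybridSystems.
Arguments hybrid_system {R} X U.

(* The exponent l ranges over the extended reals with 1 <= l; other values   *)
(* of l are junk.                                                            *)
Section TimeDilation.
Context {R : realType}.
Variables (ups : R) (l : \bar R).

Definition gain_rate (mu : R) : R :=
  match l with
  | r%:E => if r == 1 then mu / ups
            else r / (r - 1) * (mu `^ (2 - r^-1) / ups)
  | +oo%E => mu ^+ 2 / ups
  | -oo%E => 0
  end.

Definition horizon (c : R) : \bar R :=
  match l with
  | r%:E => if r == 1 then +oo%E else (ups * c `^ ((1 - r) / r))%:E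
  | +oo%E => (ups / c)%:E
  | -oo%E => 0%E
  end.

Definition dilation (c t : R) : R :=
  match l with
  | r%:E =>
      if r == 1 then ups * (c * expR (t / ups) - c)
      else (r - 1) * ups *
           (ups `^ (r - 1)^-1
              * (ups * c `^ ((1 - r) / r) - t) `^ (1 - r)^-1
            - c `^ r^-1)
  | +oo%E => ups * ln (ups / (ups - c * t))
  | -oo%E => 0
  end.

(* D_{c,l} x id, a partial map defined on [0, T_{c,l}) x nat. *)
Definition hdilation (c : R) (p : R * nat) : option (R * nat) :=
  if `[< 0 <= p.1 /\ (p.1%:E < horizon c)%E >]
  then Some (dilation c p.1, p.2) else None.

End TimeDilation.

(* The set Q = {1, ..., qbar} is indexed by 'I_qbar, the index q standing    *)
(* for the number q + 1.                                                     *)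
Record problem_data (R : realType) (n qbar : nat) := ProblemData {
  phi : R -> 'cV[R]_n ;
  Qs : {set 'I_qbar} ;
  Qi : {set 'I_qbar} ;
  Qc : {set 'I_qbar} ;
  kbar : 'I_qbar -> nat ;
  phi_rec : forall q : 'I_qbar, 'I_(kbar q) -> 'cV[R]_n ;
  kt : R ;
  kr : R ;
  T0 : R ;
  N0 : R ;
  tau_d : R ;
  tau_a : R }.

Definition loewner_le (R : realType) (n : nat) (A B : 'M[R]_n) : Prop :=
  forall v : 'cV[R]_n, 0 <= (v^T *m (B - A) *m v) ord0 ord0.

Definition Phi R n qbar (P : @problem_data R n qbar) (q : 'I_qbar) : 'M[R]_n :=
  \sum_(k < kbar P q) phi_rec k *m (phi_rec k)^T.

Record standing_assumptions R n qbar (P : @problem_data R n qbar) : Prop :=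
  StandingAssumptions {
    phi_continuous : {within `[0, +oo[%classic, continuous (phi P)} ;
    phi_bounded : exists M : R, forall t : R, 0 <= t -> `|phi P t| <= M ;
    Q_cover : Qs P :|: Qi P :|: Qc P = [set: 'I_qbar]%SET ;
    Q_disjoint : Qs P :&: (Qi P :|: Qc P) = finset.set0 ;
    (* kbar is only meaningful on Qs and Qi; the junk value 0 elsewhere     *)
    (* makes [input] below have exactly the blocks u_{2,q}, q in Qs or Qi.  *)
    kbar_junk : forall q, q \notin Qs P :|: Qi P -> kbar P q = 0%N ;
    recorded : forall q, q \in Qs P :|: Qi P ->
      forall k : 'I_(kbar P q), exists2 t : R, 0 <= t & phi_rec k = phi P t ;
    rich : forall q, q \in Qs P ->
      exists2 alpha : R, 0 < alpha & loewner_le alpha%:M (Phi P q) ;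
    poor : forall q, q \in Qi P -> forall alpha : R, 0 <= alpha ->
      (loewner_le alpha%:M (Phi P q) <-> alpha = 0) ;
    kt_gt0 : 0 < kt P ;
    kr_gt0 : 0 < kr P ;
    T0_gt0 : 0 < T0 P ;
    N0_ge1 : 1 <= N0 P ;
    tau_d_gt0 : 0 < tau_d P ;
    tau_a_gt1 : 1 < tau_a P }.

Section Systems.
Context {R : realType} {n qbar : nat}.
Variable P : problem_data R n qbar.

(* y = (q, rho_d, rho_a), x = (theta, y), z = (x, tau, mu) *)
Definition ystate : normedModType R := (R * R * R)%type.
Definition xstate : normedModType R := ('cV[R]_n * ystate)%type.
Definition zstate : normedModType R := (xstate * R * R)%type.

(* u = (u1, u2, u3), where u2 stacks the blocks u_{2,q} *)
Definition input : normedModType R :=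
  (R * 'cV[R]_(\sum_q kbar P q) * 'cV[R]_n)%type.

Definition mode (q : 'I_qbar) : R := q.+1%:R.

Definition modes : set R := range mode.

Definition eta (q : 'I_qbar) (tau : R) (u : input) : 'cV[R]_n :=
  let: (u1, u2, u3) := u in
  kt P *: (u1 *: phi P tau) + kr P *:
    (if q \in Qs P :|: Qi P
     then \sum_(k < kbar P q) submxcol u2 q k ord0 *: phi_rec k
     else u3).

Definition error_map (q : 'I_qbar) (theta : 'cV[R]_n) (tau : R) (u : input) :
    'cV[R]_n :=
  - ((kt P *: (phi P tau *m (phi P tau)^T)
      + (q \in Qs P :|: Qi P)%:R *: (kr P *: Phi P q)) *m theta)
  + eta q tau u.

Definition C_sigma : set ystate :=
  modes `*` `[0, N0 P]%classic `*` `[0, T0 P]%classic.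

Definition F_sigma (q : 'I_qbar) : set ystate :=
  [set 0] `*` `[0, (tau_d P)^-1]%classic
  `*` [set r - (q \in Qi P :|: Qc P)%:R | r in `[0, (tau_a P)^-1]%classic].

Definition D_sigma : set ystate :=
  modes `*` `[1, N0 P]%classic `*` `[0, T0 P]%classic.

Definition G_sigma (y : ystate) : set ystate :=
  let: (q, rho_d, rho_a) := y in
  (modes `\ q) `*` [set rho_d - 1] `*` [set rho_a].

(* The union has a single term when the first component of y lies in        *)
(* {1, ..., qbar}, as it does on C_z.                                        *)
Definition F_x (x : xstate) (tau : R) (u : input) : set xstate :=
  let: (theta, (q, _, _)) := x in
  \bigcup_(i in [set i | mode i = q])
    ([set error_map i theta tau u] `*` F_sigma i).

Definition C_z : set zstate :=
  [set: 'cV[R]_n] `*` C_sigma `*` `[0, +oo[%classic `*` `[1, +oo[%classic.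

Definition D_z : set zstate :=
  [set: 'cV[R]_n] `*` D_sigma `*` `[0, +oo[%classic `*` `[1, +oo[%classic.

Definition G_z (z : zstate) (u : input) : set zstate :=
  let: ((theta, y), tau, mu) := z in
  [set theta] `*` G_sigma y `*` [set tau] `*` [set mu].

Variables (ups : R) (l : \bar R).

Definition nominal : hybrid_system zstate input :=
  HybridSystem (C_z `*` [set: input])
    (fun z u => let: (x, tau, mu) := z in
       [set mu *: v | v in F_x x tau u] `*` [set 1]
       `*` [set gain_rate ups l mu])
    (D_z `*` [set: input]) G_z.

Definition target : hybrid_system zstate input :=
  HybridSystem (C_z `*` [set: input])
    (fun z u => let: (x, tau, mu) := z in
       F_x x tau u `*` [set mu^-1] `*` [set mu^-1 * gain_rate ups l mu])
    (D_z `*` [set: input]) G_z.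

Definition init_gain (z : hfun R zstate) : R := (hval z 0 0).2.

(* Composition of partial functions: the result is defined at r iff          *)
(* [hdilation] is defined at r with value in the domain of the arc (input).  *)
Definition W (p : hfun R zstate * hfun R input) :
    hfun R zstate * hfun R input :=
  let DD := hdilation ups l (init_gain p.1) in
  (obind p.1 \o DD, obind p.2 \o DD).

End Systems.

(* Main.v *)
Require Import Defs.
From mathcomp Require Import all_boot all_order all_algebra.
From mathcomp Require Import all_classical all_reals all_analysis.
From mathcomp Require Import measurable_realfun ring lra.
Import Order.TTheory GRing.Theory Num.Theory.
Import numFieldNormedType.Exports.

Set Implicit Arguments.
Unset Strict Implicit.
Unset Printing Implicit Defensive.

Local Open Scope classical_set_scope.
Local Open Scope ring_scope.

(** The gain evolves autonomously in both systems, so it can serve as a clock.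
    Write F (x) for its rate of change at the gain x, and choose functions of
    x >= 1 with derivatives
      g' = 1 / F   and   h' = x / F.
    Along every solution of the nominal system, g (mu (t, j)) = g c + t, and
    along every solution of the target system, h (mu (s, j)) = h c + s, where
    c is the initial gain; this is [gain_equation].  Jumps leave the gain
    unchanged, so the equation crosses them, and on flows it says that an
    absolutely continuous function whose derivative is 1 almost everywhere
    has slope 1, which is [abs_continuous_constant_derive].  Reading the same
    gain on both clocks matches the ordinary times t = g x - g c and
    s = h x - h c, for x >= c.  The explicit formulas say exactly that this
    matching is the dilation D_c, that t then ranges over 0 <= t < T_c and s over
    all s >= 0 ([gain_primitives_exist]).

    The matching t |-> s is an increasing bijection, with derivative
    h' / g' = x, the common gain at the matched times; it is Lipschitz on
    compact intervals, and so is its inverse.  Composition with such a change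
    of time preserves hybrid time domains, absolute continuity, Lebesgue
    measurability, local essential boundedness and null sets, and it
    multiplies velocities by its derivative ([solution_retime]).
    Multiplication by the gain turns the target flow into the nominal flow,
    and division by it does the converse, so W and the composition with the
    inverse dilations are mutually inverse maps between all solutions.
    No nominal solution escapes the domain of the dilation, since
    g c + t = g (mu) stays below g c + T_c.  Both maps preserve
    the initial gain and the extension order, hence they also match maximal
    solutions ([set_bij_maximal]). *)

(** * Absolutely continuous functions *)

(** A least-upper-bound form of Cousin's lemma: a property that can be carried
    across a neighbourhood of each point can be carried from a to b.  It does
    the work of tagged partitions subordinate to a gauge. *)
Lemma real_induction (R : realType) (T : R -> Prop) (a b : R) :
  a <= b -> T a ->
  (forall y, a <= y <= b -> exists2 d, 0 < d &
    forall x z, a <= x <= y -> y <= z <= b -> y - d < x -> z < y + d ->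
      T x -> T z) ->
  T b.
Proof.
move=> ab Ta step.
pose E : set R := [set x | a <= x <= b /\ T x].
have Ea : E a by rewrite /E /= lexx.
have ubE : ubound E b by move=> x [/andP[_ ?] _].
have supE : has_sup E by split; [exists a | exists b].
have aS : a <= sup E by exact: sup_upper_bound.
have Sb : sup E <= b by exact: ge_sup (ex_intro _ a Ea) ubE.
have [|d d0 stepd] := step (sup E); first by rewrite aS.
have [x [/andP[ax xb] Tx] dx] := sup_adherent d0 supE.
have xS : x <= sup E by apply: sup_upper_bound => //; rewrite /E /= ax xb.
pose z := Num.min b (sup E + d / 2).
have Sz : sup E <= z by rewrite le_min Sb lerDl divr_ge0// ltW.
have zb : z <= b by rewrite ge_min lexx.
have zd : z < sup E + d by rewrite gt_min; apply/orP; right; lra.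
have Tz : T z by apply: (stepd x) => //; rewrite ?ax ?Sz.
have : z <= sup E.
  by apply: sup_upper_bound => //; split => //; rewrite zb (le_trans aS).
rewrite /z ge_min => /orP[bS|]; last by lra.
by rewrite (_ : b = z)//; apply/eqP; rewrite eq_le zb (le_trans bS Sz).
Qed.

Section ConstantDerivative.
Context {R : realType}.
Local Notation mu := (@lebesgue_measure R).

Lemma trivIset_ordered_oo (m : nat) (s t : nat -> R) :
  (forall i j, (i < j < m)%N -> t i <= s j) ->
  trivIset setT (fun k : 'I_m => `]s k, t k[%classic).
Proof.
move=> ord i j _ _ [x [/=]]; rewrite !in_itv /= => /andP[si ti] /andP[sj tj].
apply/val_inj => /=; case: (ltngtP i j) => // ij.
- by have := ord i j; rewrite ij ltn_ord => /(_ isT) tisj; exfalso; lra.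
- by have := ord j i; rewrite ij ltn_ord => /(_ isT) tisj; exfalso; lra.
Qed.

Lemma sum_length_le_measure (m : nat) (s t : nat -> R) (O : set R) :
  (forall i, (i < m)%N -> s i <= t i) ->
  (forall i j, (i < j < m)%N -> t i <= s j) ->
  (forall i, (i < m)%N -> `]s i, t i[%classic `<=` O) -> open O ->
  ((\sum_(i < m) (t i - s i))%:E <= mu O)%E.
Proof.
move=> st ord sub oO.
have len i : (i < m)%N -> mu `]s i, t i[%classic = (t i - s i)%:E.
  move=> im; rewrite lebesgue_measure_itv /= lte_fin.
  case: ltP => // ts; rewrite (_ : s i = t i) ?subrr//.
  by apply/eqP; rewrite eq_le ts st.
have -> : (\sum_(i < m) (t i - s i))%:E =
    mu (\big[setU/set0]_(i < m) `]s i, t i[%classic).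
  rewrite measure_bigsetU_ord//; last exact: trivIset_ordered_oo.
  by rewrite -sumEFin; apply: eq_bigr => i _; rewrite -len.
apply: le_measure; rewrite ?inE.
- by apply: bigsetU_measurable => i _; exact: measurable_itv.
- exact: open_measurable.
- by rewrite -(bigcup_mkord m (fun i => `]s i, t i[%classic)) => x [i im]; apply: sub.
Qed.

(** The interval from a to b is cut into short intervals subordinate to a
    gauge.  Around a point where the derivative is k, the increment of f
    differs from that of k * id by at most e times the length.  The points of
    the exceptional null set get intervals inside an open set of small
    measure; the total increment of f over these is small by absolute
    continuity. *)
Lemma abs_continuous_constant_derive (a b k : R) (f : R -> R) :
  a <= b -> abs_continuous a b f ->
  {ae mu, forall t, a <= t <= b -> is_derive t 1 f k} ->
  f b - f a = k * (b - a).
Proof.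
move=> ab ACf [N0 [mN0 N00 subN]].
apply/eqP; rewrite -subr_eq0 -normr_le0; apply/ler_addgt0Pr => e' e'0.
rewrite add0r.
pose C := b - a + 1 + `|k|.
have C0 : 0 < C by rewrite /C; have := normr_ge0 k; lra.
pose e := e' / C.
have e0 : 0 < e by rewrite divr_gt0.
have [d d0 ACd] := ACf e e0.
pose eta := Num.min d e.
have eta0 : 0 < eta by rewrite lt_min d0.
have [V [oV N0V muV]] : exists V : set R,
    [/\ open V, N0 `<=` V & (mu V < eta%:E)%E].
  have N0fin : (mu N0 < +oo)%E by rewrite [mu N0]N00 ltry.
  have [U [oU AU mU]] := lebesgue_regularity_outer mN0 N0fin eta0.
  exists U; split => //; apply: le_lt_trans mU.
  have mU : measurable U by exact: open_measurable.
  have -> : mu U = (mu (U `\` N0) + mu N0)%E.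
    rewrite -measureU//; first by rewrite setDKU.
    - exact: measurableD.
    - by rewrite setDE -setIA setICl setI0.
  by rewrite [mu N0]N00 adde0.
(* The intervals (s i, t i) collect the pieces tagged in the null set; all
   the other pieces contribute to the term e * (x - a). *)
pose dev x y := f y - f x - k * (y - x).
pose T x := exists (m : nat) (s t : nat -> R), [/\
  (forall i, (i < m)%N -> [/\ a <= s i, s i <= t i & t i <= x]),
  (forall i j, (i < j < m)%N -> t i <= s j),
  (forall i, (i < m)%N -> `]s i, t i[%classic `<=` V) &
  `|dev a x| <= e * (x - a) + \sum_(i < m) `|dev (s i) (t i)| ].
have [m [s [t [st ord stV Hb]]]] : T b.
  apply: (@real_induction R T a b) => //.
    exists 0%N, (fun=> 0), (fun=> 0); split => //.
    by rewrite /dev !subrr mulr0 subrr normr0 big_ord0 addr0 mulr0.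
  move=> y yab; have [N0y|N0y] := pselect (N0 y).
  - have [r /= r0 rV] : nbhs y V by apply: open_nbhs_nbhs; split => //; exact: N0V.
    exists r => // x z /andP[ax xy] /andP[yz zb] yrx zyr [m [s [t [st ord stV Hx]]]].
    exists m.+1, (fun i => if (i < m)%N then s i else x),
                 (fun i => if (i < m)%N then t i else z).
    split.
    + move=> i _; case: ifPn => im; last by split => //; lra.
      by have [? ? ?] := st _ im; split => //; lra.
    + move=> i j /andP[ij jm].
      have im : (i < m)%N by apply: leq_trans ij _.
      rewrite im; case: ifPn => jm'; first by apply: ord; rewrite ij.
      by have [] := st _ im.
    + move=> i _; case: ifPn => im; first exact: stV.
      move=> w /=; rewrite in_itv /= => /andP[xw wz]; apply: rV => /=.
      by rewrite ltr_norml; apply/andP; split; lra.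
    + rewrite big_ord_recr /= ltnn.
      under eq_bigr do rewrite ltn_ord.
      have -> : dev a z = dev a x + dev x z by rewrite /dev; lra.
      have := ler_normD (dev a x) (dev x z).
      have : e * (x - a) <= e * (z - a) by apply: ler_wpM2l; lra.
      by lra.
  - have dfy : is_derive y 1 f k.
      by apply: contrapT => H; apply: N0y; apply: subN => /=; apply/existsNP; exists yab.
    have /is_derive1_caratheodory [g [gE gC gy]] := dfy.
    have [r /= r0 rg] : \forall w \near y, `|g y - g w| < e.
      by move/cvgrPdist_lt : gC => /(_ _ e0).
    have devy w : `|y - w| < r -> `|dev y w| <= e * `|w - y|.
      move=> yw; rewrite /dev gE -gy -mulrBl normrM distrC.
      by apply: ler_wpM2r => //; apply: ltW; exact: rg.
    exists r => // x z /andP[ax xy] /andP[yz zb] yrx zyr [m [s [t [st ord stV Hx]]]].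
    exists m, s, t; split => //.
      by move=> i im; have [? ? ?] := st _ im; split => //; lra.
    have -> : dev a z = dev a x + (dev y z - dev y x) by rewrite /dev; lra.
    have h1 : `|dev y z| <= e * (z - y).
      rewrite -(@ger0_norm _ (z - y)) ?subr_ge0//; apply: devy.
      by rewrite ltr_norml; apply/andP; split; lra.
    have h2 : `|dev y x| <= e * (y - x).
      rewrite -(@ger0_norm _ (y - x)) ?subr_ge0// [`|y - x|]distrC; apply: devy.
      by rewrite ltr_norml; apply/andP; split; lra.
    have := ler_normD (dev a x) (dev y z - dev y x).
    have := ler_normB (dev y z) (dev y x).
    by lra.
have len : \sum_(i < m) (t i - s i) < eta.
  rewrite -lte_fin; apply: le_lt_trans muV.
  by apply: sum_length_le_measure => // i /st[].
have devsum : \sum_(i < m) `|dev (s i) (t i)| <= e + `|k| * e.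
  apply: (@le_trans _ _ (\sum_(i < m) (`|f (t i) - f (s i)| + `|k| * (t i - s i)))).
    apply: ler_sum => i _; have [_ sti _] := st i (ltn_ord i).
    apply: le_trans (ler_normB _ _) _; rewrite normrM.
    by rewrite (@ger0_norm _ (t i - s i)) ?subr_ge0.
  rewrite big_split -mulr_sumr; apply: lerD.
    apply: ltW; apply: (ACd m (fun i => s i) (fun i => t i)).
    - by move=> i; exact: st.
    - exact: trivIset_ordered_oo.
    - by apply: lt_le_trans len _; rewrite ge_min lexx.
  apply: ler_wpM2l => //; apply: ltW; apply: lt_le_trans len _.
  by rewrite ge_min lexx orbT.
apply: le_trans Hb _.
apply: (@le_trans _ _ (e * C)); first by rewrite /C; lra.
by rewrite /e divfK ?gt_eqF.
Qed.

End ConstantDerivative.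

Section AbsContinuous.
Context {R : realType}.

Lemma abs_continuous_dist (V : normedModType R) (a b : R) (f : R -> V) :
  abs_continuous a b f -> forall e, 0 < e -> exists2 d, 0 < d &
    forall s t, a <= s -> s <= t -> t <= b -> t - s < d -> `|f t - f s| < e.
Proof.
move=> ACf e e0; have [d d0 H] := ACf e e0; exists d => // s t las lst ltb std.
have := H 1%N (fun=> s) (fun=> t); rewrite !big_ord1; apply => //.
by move=> i j _ _ _; rewrite !ord1.
Qed.

Lemma abs_continuous_lipschitz (V W : normedModType R) (a b L : R)
    (f : R -> V) (g : V -> W) :
  0 < L ->
  (forall s t, a <= s -> s <= t -> t <= b ->
    `|g (f t) - g (f s)| <= L * `|f t - f s|) ->
  abs_continuous a b f -> abs_continuous a b (g \o f).
Proof.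
move=> L0 lip ACf e e0; have [d d0 H] := ACf _ (divr_gt0 e0 L0).
exists d => // m s t st triv len; have := H m s t st triv len.
rewrite ltr_pdivlMr// mulrC mulr_sumr; apply: le_lt_trans.
by apply: ler_sum => k _; have [? ? ?] := st k; exact: lip.
Qed.

Lemma abs_continuous_comp (V : normedModType R) (a b K : R)
    (f : R -> V) (th : R -> R) :
  0 < K ->
  (forall s t, a <= s -> s <= t -> t <= b -> th s <= th t) ->
  (forall s t, a <= s -> s <= t -> t <= b -> th t - th s <= K * (t - s)) ->
  abs_continuous (th a) (th b) f -> abs_continuous a b (f \o th).
Proof.
move=> K0 mono lip ACf e e0; have [d d0 H] := ACf e e0.
exists (d / K); first by rewrite divr_gt0.
move=> m s t st triv len; apply: (H m (th \o s) (th \o t)).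
- move=> k; have [ask skt tkb] := st k.
  by split; apply: mono => //=; lra.
- move=> i j _ _ [x [/=]]; rewrite !in_itv /= => /andP[si ti] /andP[sj tj].
  have [asi sti tib] := st i; have [asj stj tjb] := st j.
  apply: triv => //.
  have ij : s i < t j.
    rewrite ltNge; apply/negP => ?.
    have : th (t j) <= th (s i) by apply: mono => //; lra.
    by lra.
  have ji : s j < t i.
    rewrite ltNge; apply/negP => ?.
    have : th (t i) <= th (s j) by apply: mono => //; lra.
    by lra.
  have sti' : s i < t i.
    rewrite ltNge; apply/negP => ?.
    have : th (t i) <= th (s i) by rewrite (_ : t i = s i)//;
        apply/eqP; rewrite eq_le; apply/andP.
    by lra.
  have stj' : s j < t j.
    rewrite ltNge; apply/negP => ?.
    have : th (t j) <= th (s j) by rewrite (_ : t j = s j)//;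
        apply/eqP; rewrite eq_le; apply/andP.
    by lra.
  (* th is only nondecreasing, but intervals with nondegenerate images
     overlap as soon as their images do. *)
  pose lo := Num.max (s i) (s j); pose hi := Num.min (t i) (t j).
  have lohi : lo < hi by rewrite /lo /hi gt_max !lt_min sti' stj' ij ji.
  have [lo1 lo2] : s i <= lo /\ s j <= lo by rewrite !le_max !lexx orbT.
  have [hi1 hi2] : hi <= t i /\ hi <= t j by rewrite !ge_min !lexx orbT.
  exists ((lo + hi) / 2); split; rewrite /= in_itv /=; apply/andP; split; lra.
- rewrite ltr_pdivlMr// mulrC mulr_sumr in len; apply: le_lt_trans len.
  by apply: ler_sum => k _; have [? ? ?] := st k; exact: lip.
Qed.

End AbsContinuous.

(** * Null sets and measurability *)

(** A cover by open intervals is mapped into a cover by intervals that are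
    longer by a bounded factor. *)
Lemma negligible_lipschitz_image (R : realType) (D N : set R) (K : R) (f : R -> R) :
  (forall x y, D x -> D y -> `|f x - f y| <= K * `|x - y|) ->
  N `<=` D -> lebesgue_measure.-negligible N ->
  (@lebesgue_measure R).-negligible (f @` N).
Proof.
move=> lipf ND /negligible_outer_measure N0; apply/negligible_outer_measure.
apply/eqP; rewrite eq_le outer_measure_ge0 andbT; apply/lee_addgt0Pr => e e0.
rewrite add0e.
(* K may be 0 or negative; `|K| + 1 keeps the intervals nondegenerate. *)
pose L := 2 * (`|K| + 1).
have L0 : 0 < L by rewrite mulr_gt0// ltr_wpDl.
have eL0 : (0 < (e / L)%:E)%E by rewrite lte_fin divr_gt0.
have /ereal_inf_lt[_ /= [F [Fitv NF] <-] sumF] :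
    (ereal_inf [set \sum_(k <oo) wlength idfun (F k) | F in @open_itv_cover _ R N]%E
      < (e / L)%:E)%E.
  by rewrite -outer_measure_open_itv_cover N0.
have len0 k : (0 <= wlength idfun (F k))%E.
  by have [ab -> ] := Fitv k; apply: wlength_itv_ge0.
have fNF : f @` N `<=` \bigcup_k (f @` (N `&` F k)).
  by move=> _ [x Nx <-]; have [k _ Fkx] := NF _ Nx; exists k => //; exists x.
apply: (@le_trans _ _ ((wlength idfun)^*%mu (\bigcup_k (f @` (N `&` F k))))).
  exact: le_outer_measure.
apply: (@le_trans _ _ (\sum_(k <oo) (wlength idfun)^*%mu (f @` (N `&` F k)))%E).
  exact: outer_measure_sigma_subadditive.
apply: (@le_trans _ _ (\sum_(k <oo) (L%:E * wlength idfun (F k)))%E).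
  apply: lee_nneseries => [k _ _|k _]; first exact: outer_measure_ge0.
  have [[a b] /= Fk] := Fitv k.
  have [->|/set0P[x0 [Nx0 Fx0]]] := eqVneq (N `&` F k) set0.
    rewrite image_set0 outer_measure0.
    by apply: mule_ge0; [rewrite lee_fin ltW|exact: len0].
  have ab : a < b by move: Fx0; rewrite Fk /= in_itv /= => /andP[]; exact: lt_trans.
  pose r := (`|K| + 1) * (b - a).
  have r0 : 0 < r by rewrite mulr_gt0 ?subr_gt0// ltr_wpDl.
  have sub : f @` (N `&` F k) `<=` `[f x0 - r, f x0 + r]%classic.
    move=> _ [x [Nx Fx] <-] /=; rewrite in_itv /= -ler_distl.
    apply: le_trans (lipf _ _ (ND _ Nx) (ND _ Nx0)) _.
    apply: (@le_trans _ _ ((`|K| + 1) * `|x - x0|)).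
    - by apply: ler_wpM2r => //; apply: le_trans (ler_norm _) _; rewrite lerDl.
    - apply: ler_wpM2l; first by rewrite addr_ge0.
      apply: ltW; move: Fx0 Fx; rewrite Fk /= !in_itv /= => /andP[? ?] /andP[? ?].
      by rewrite ltr_norml; apply/andP; split; lra.
  apply: (@le_trans _ _ (@lebesgue_measure R `[f x0 - r, f x0 + r]%classic)).
    exact: le_outer_measure.
  rewrite lebesgue_measure_itv /= lte_fin ifT; last by lra.
  rewrite Fk wlength_itv /= lte_fin ab -!EFinD -EFinM lee_fin /r /L; lra.
rewrite nneseriesZl; last by move=> k _; exact: len0.
apply: (@le_trans _ _ (L%:E * (e / L)%:E)%E); last first.
  by rewrite -EFinM lee_fin mulrC divfK// gt_eqF.
by apply: lee_wpmul2l; [rewrite lee_fin ltW|exact: ltW].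
Qed.

Lemma measurable_nondecreasing_itv (R : realType) (S : set R) (f : R -> R) :
  is_interval S -> {in S &, {homo f : x y / x <= y}} -> measurable_fun S f.
Proof.
move=> itvS ndf; apply: (measurability _ (RGenInftyO.measurableE R)).
move=> _ [_ [x ->] <-]; apply: is_interval_measurable => u v [Su fu] [Sv fv] w.
move=> /andP[uw wv]; have Sw : S w by apply: (itvS u v) => //; rewrite uw wv.
split=> //=; rewrite in_itv /=; move: fv => /=; rewrite in_itv /=.
by apply: le_lt_trans; apply: ndf; rewrite ?inE.
Qed.

(** * Changes of time *)

Section TimeChange.
Context {R : realType}.

(** An increasing map between half-open time intervals starting at 0.
    [clock_nomax] excludes right end points, where composition would lose the
    two-sided derivative, and [clock_exhaust] gives the countable exhaustion
    that reduces almost-everywhere statements to compact intervals, on which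
    the Lipschitz constants of [clock_lip] are available. *)
Record clock_map (S1 S2 : set R) (th : R -> R) : Prop := ClockMap {
  clock0 : S1 0 /\ th 0 = 0 ;
  clock_ge0 : forall t, S1 t -> 0 <= t ;
  clock_down : forall s t, 0 <= s -> s <= t -> S1 t -> S1 s ;
  clock_nomax : forall t, S1 t -> exists2 t', S1 t' & t < t' ;
  clock_exhaust : exists2 b : nat -> R, forall k, S1 (b k) &
    forall t, S1 t -> exists k, t <= b k ;
  clock_maps : forall t, S1 t -> S2 (th t) ;
  clock_lt : forall s t, S1 s -> S1 t -> s < t -> th s < th t ;
  clock_lip : forall b, S1 b -> exists2 K, 0 < K &
    forall s t, 0 <= s -> s <= t -> t <= b -> th t - th s <= K * (t - s) }.

Record time_change (S1 S2 : set R) (th ka : R -> R) : Prop := TimeChange {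
  time_change_clock : clock_map S1 S2 th ;
  time_change_clockV : clock_map S2 S1 ka ;
  time_changeK : forall t, S1 t -> ka (th t) = t ;
  time_changeVK : forall s, S2 s -> th (ka s) = s }.

Lemma time_change_sym S1 S2 th ka :
  time_change S1 S2 th ka -> time_change S2 S1 ka th.
Proof. by case. Qed.

Lemma clock_le S1 S2 th : clock_map S1 S2 th ->
  forall s t, S1 s -> S1 t -> s <= t -> th s <= th t.
Proof.
move=> C s t Ss St; rewrite le_eqVlt => /orP[/eqP->//|st].
by apply: ltW; exact: (clock_lt C).
Qed.

Section Theory.
Context (S1 S2 : set R) (th ka : R -> R) (TC : time_change S1 S2 th ka).
Let C := time_change_clock TC.
Let C' := time_change_clockV TC.

Lemma time_change_leE s t : S1 s -> S1 t -> (th s <= th t) = (s <= t).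
Proof.
move=> Ss St; apply/idP/idP; last exact: clock_le C _ _ Ss St.
by rewrite !leNgt; apply: contra; exact: clock_lt C _ _ St Ss.
Qed.

Lemma time_change_ltE s t : S1 s -> S1 t -> (th s < th t) = (s < t).
Proof. by move=> Ss St; rewrite !ltNge time_change_leE. Qed.

Lemma time_change_is_interval : is_interval S1.
Proof.
move=> s t Ss St u /andP[su ut]; apply: (clock_down C _ ut St).
exact: le_trans (clock_ge0 C Ss) su.
Qed.

Lemma time_change_near t : S1 t -> 0 < t -> \forall u \near t, S1 u.
Proof.
move=> St t0; have [t' St' tt'] := clock_nomax C St.
near=> u; apply: (clock_down C _ _ St'); last by apply: ltW; near: u; exact: lt_nbhsl.
by apply: ltW; near: u; exact: lt_nbhsr.
Unshelve. all: by end_near. Qed.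

(** The preimage is the image under the inverse, which is Lipschitz on
    each interval of the exhaustion. *)
Lemma negligible_time_change (N : set R) :
  (@lebesgue_measure R).-negligible N ->
  (@lebesgue_measure R).-negligible (S1 `&` th @^-1` N).
Proof.
move=> N0; have [b Sb bE] := clock_exhaust C'.
pose Nk k := [set ka s | s in N `&` [set s | S2 s /\ s <= b k]].
have sub : S1 `&` th @^-1` N `<=` \bigcup_k Nk k.
  move=> t [St Nt]; have Sth := clock_maps C St; have [k tk] := bE _ Sth.
  by exists k => //; exists (th t) => //; exact: (time_changeK TC).
apply: negligibleS; first exact: sub.
apply: negligible_bigcup => k; have [K K0 lipK] := clock_lip C' (Sb k).
apply: (@negligible_lipschitz_image _ [set s | S2 s /\ s <= b k] _ K).
- move=> x y [Sx xb] [Sy yb]; wlog xy : x y Sx xb Sy yb / y <= x.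
    by move=> H; have [|/ltW] := leP y x; [|rewrite distrC (distrC x)]; apply: H.
  rewrite !ger0_norm ?subr_ge0//.
    by apply: lipK => //; exact: (clock_ge0 C').
  exact: (clock_le C').
- by move=> s [].
- by apply: negligibleS N0 => s [].
Qed.

Lemma measurable_time_change : measurable_fun S1 th.
Proof.
apply: measurable_nondecreasing_itv; first exact: time_change_is_interval.
by move=> s t; rewrite !inE; exact: (clock_le C).
Qed.

End Theory.

Definition retime (X : Type) (S : set R) (th : R -> R) (z : hfun R X) :
    hfun R X :=
  fun r => if `[< S r.1 >] then z (th r.1, r.2) else None.

Lemma retimeE X S th (z : hfun R X) t j : S t ->
  retime S th z (t, j) = z (th t, j).
Proof. by move=> St; rewrite /retime /=; case: asboolP. Qed.

Lemma hdom_retime X S th (z : hfun R X) t j :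
  hdom (retime S th z) (t, j) <-> S t /\ hdom z (th t, j).
Proof. by rewrite /hdom /retime /=; case: asboolP => // St; split => [|[]]. Qed.

Lemma hval_retime (X : nmodType) S th (z : hfun R X) t j : S t ->
  hval (retime S th z) j t = hval z j (th t).
Proof. by move=> St; rewrite /hval retimeE. Qed.

Lemma retimeK X S1 S2 th ka (z : hfun R X) : time_change S1 S2 th ka ->
  (forall r, hdom z r -> S2 r.1) -> retime S2 ka (retime S1 th z) = z.
Proof.
move=> TC zS; apply/funext => -[s j]; have [Ss|NSs] := pselect (S2 s).
  rewrite retimeE// retimeE ?(time_changeVK TC)//.
  exact: (clock_maps (time_change_clockV TC)).
have /contrapT -> : ~ ~ (z (s, j) = None) by move/(zS (s, j)).
by rewrite /retime /=; case: asboolP.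
Qed.

(** The switching times of each truncation are transported by the inverse. *)
Lemma hybrid_time_domain_retime X S1 S2 th ka (z : hfun R X) :
  time_change S1 S2 th ka -> (forall r, hdom z r -> S2 r.1) ->
  hybrid_time_domain (hdom z) -> hybrid_time_domain (hdom (retime S1 th z)).
Proof.
move=> TC zS [z0 ztrunc].
have C := time_change_clock TC; have C' := time_change_clockV TC.
split=> [[t j] /hdom_retime[St _]|]; first exact: (clock_ge0 C).
move=> [T J'] /= /hdom_retime[ST zT].
have [J [t [t0 tmono tE]]] := ztrunc _ zT.
have tz j s : (j < J)%N -> t j <= s <= t j.+1 ->
    hdom z (s, j) /\ [/\ 0 <= s, s <= th T & (j <= J')%N].
  move=> jJ sj.
  have : (hdom z `&` [set r | 0 <= r.1 <= th T /\ (r.2 <= J')%N]) (s, j).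
    by rewrite tE.
  by move=> [zs [/andP[? ?] ?]].
have tS j : (j < J)%N -> S2 (t j) /\ S2 (t j.+1).
  move=> jJ; split; apply: (zS (_, j)); apply: proj1 (tz j _ jJ _);
  by rewrite ?lexx ?tmono.
exists J, (ka \o t); split => [|j jJ|] /=.
- by rewrite t0; have [_] := clock0 C'.
- by have [? ?] := tS j jJ; apply: (clock_le C') => //; exact: tmono.
- apply/seteqP; split => [[s j]|[s j]] /=.
  + move=> [/hdom_retime[Ss zs] [/andP[s0 sT] jJ']].
    have : [set p | (p.2 < J)%N /\ t p.2 <= p.1 <= t p.2.+1] (th s, j).
      rewrite -tE; split => //=; split => //.
      by rewrite (time_change_leE TC)// sT andbT; apply: (z0 _ zs).
    move=> /= [jJ /andP[tjs stj]]; split => //.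
    have [Stj Stj1] := tS j jJ.
    by rewrite -(time_changeK TC Ss) !(time_change_leE (time_change_sym TC)) ?tjs//;
      exact: (clock_maps C).
  + move=> [jJ /andP[tjs stj]]; have [Stj Stj1] := tS j jJ.
    have Ss : S1 s.
      apply: (clock_down C _ stj); last exact: (clock_maps C').
      apply: le_trans tjs; apply: (clock_ge0 C); exact: (clock_maps C').
    have ths : t j <= th s <= t j.+1.
      rewrite -(time_changeVK TC Stj) -(time_changeVK TC Stj1).
      by rewrite !(time_change_leE TC) ?tjs//; exact: (clock_maps C').
    have [zs [s0 sT jJ']] := tz j _ jJ ths.
    split; first exact/hdom_retime.
    by rewrite (clock_ge0 C Ss) -(time_change_leE TC).
Qed.

Lemma itv_retime X S1 S2 th ka (z : hfun R X) a b j :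
  time_change S1 S2 th ka -> (forall r, hdom z r -> S2 r.1) -> a <= b ->
  `[a, b]%classic `<=` hslice (retime S1 th z) j ->
  [/\ S1 a, S1 b & `[th a, th b]%classic `<=` hslice z j].
Proof.
move=> TC zS ab sub.
have C := time_change_clock TC; have C' := time_change_clockV TC.
have /hdom_retime[Sa za] : hslice (retime S1 th z) j a.
  by apply: sub; rewrite /= in_itv /= lexx.
have /hdom_retime[Sb zb] : hslice (retime S1 th z) j b.
  by apply: sub; rewrite /= in_itv /= lexx ab.
split=> // s /=; rewrite in_itv /= => /andP[as_ sb].
have Ss : S2 s.
  by apply: (clock_down C' _ sb (clock_maps C Sb));
    exact: le_trans (clock_ge0 C' (zS _ za)) as_.
have Sks := clock_maps C' Ss.
have /hdom_retime[_] : hslice (retime S1 th z) j (ka s).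
  apply: sub; rewrite /= in_itv /=.
  rewrite -(time_change_leE TC Sa Sks) -(time_change_leE TC Sks Sb).
  by rewrite (time_changeVK TC Ss) as_.
by rewrite (time_changeVK TC Ss).
Qed.

Lemma hybrid_arc_retime (X : normedModType R) S1 S2 th ka (z : hfun R X) :
  time_change S1 S2 th ka -> (forall r, hdom z r -> S2 r.1) ->
  hybrid_arc z -> hybrid_arc (retime S1 th z).
Proof.
move=> TC zS [htd AC]; split; first exact: hybrid_time_domain_retime TC zS htd.
have C := time_change_clock TC.
move=> j a b ab sub; have [Sa Sb subz] := itv_retime TC zS ab sub.
have [K K0 lipK] := clock_lip C Sb.
have a0 := clock_ge0 C Sa.
have Sab s : a <= s -> s <= b -> S1 s.
  by move=> as_ sb; apply: (clock_down C _ sb Sb); exact: le_trans a0 as_.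
have AC1 : abs_continuous a b (hval z j \o th).
  apply: (@abs_continuous_comp _ _ _ _ K) => //.
  - move=> s t as_ st tb; apply: (clock_le C) => //; apply: Sab => //.
      exact: le_trans tb.
    exact: le_trans st.
  - by move=> s t as_ st tb; apply: lipK => //; exact: le_trans as_.
  - by apply: AC => //; rewrite (time_change_leE TC).
move=> e e0; have [d d0 H] := AC1 e e0; exists d => // m s t st triv len.
have := H m s t st triv len; congr (_ < _); apply: eq_bigr => k _ /=.
have [ask skt tkb] := st k.
by rewrite !hval_retime//; apply: Sab => //; lra.
Qed.

Lemma hybrid_input_retime (U : normedModType R) S1 S2 th ka (u : hfun R U) :
  time_change S1 S2 th ka -> (forall r, hdom u r -> S2 r.1) ->
  hybrid_input u -> hybrid_input (retime S1 th u).
Proof.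
move=> TC uS [htd umb]; split; first exact: hybrid_time_domain_retime TC uS htd.
have C := time_change_clock TC.
move=> j; have [um ub] := umb j; split.
- move=> O oO; have [A mA [N negN ANE]] := um O oO.
  exists (S1 `&` th @^-1` A).
    apply: (measurable_time_change TC) => //.
    by apply: is_interval_measurable; exact: time_change_is_interval TC.
  exists (S1 `&` th @^-1` N); first exact: negligible_time_change TC _ negN.
  rewrite -setIUr -preimage_setU ANE; apply/seteqP; split => t /=.
  + by move=> [St [zt Ot]]; split; [exact/hdom_retime|rewrite hval_retime].
  + by move=> [/hdom_retime[St zt]]; rewrite hval_retime.
- move=> a b ab sub; have [Sa Sb subz] := itv_retime TC uS ab sub.
  have [|M HM] := ub (th a) (th b) _ subz; first by rewrite (time_change_leE TC).
  exists M; apply: negligibleS (negligible_time_change TC HM) => t /= /not_implyP[].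
  rewrite in_itv /= => /andP[ta tb].
  have St : S1 t.
    by apply: (clock_down C _ tb Sb); exact: le_trans (clock_ge0 C Sa) ta.
  rewrite hval_retime// => H; split => //; apply/not_implyP; split => //.
  by rewrite in_itv /= !(time_change_leE TC)// ta.
Qed.

Lemma is_derive_comp_scale (V : normedModType R) (f : R -> V) (th : R -> R)
    (t d : R) (v : V) :
  is_derive (th t) 1 f v -> is_derive t 1 th d ->
  is_derive t 1 (f \o th) (d *: v).
Proof.
move=> [df <-] [dth <-].
have Df : differentiable f (th t) by exact/derivable1_diffP.
have Dth : differentiable th t by exact/derivable1_diffP.
have Dc : differentiable (f \o th) t by exact: differentiable_comp.
split; first exact/derivable1_diffP.
rewrite deriveE// diff_comp//= !deriveE//.
by rewrite -[in LHS](mulr1 ('d th t 1)) -linearZ.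
Qed.

Lemma interior_retime X S1 S2 th ka (z : hfun R X) j t :
  time_change S1 S2 th ka -> (forall r, hdom z r -> S2 r.1) ->
  (hslice (retime S1 th z) j)° t -> S1 t /\ (hslice z j)° (th t).
Proof.
move=> TC zS [e /= e0 sub].
have ab : t - e / 2 <= t + e / 2 by lra.
have [|Sa Sb subz] := itv_retime (j := j) TC zS ab _.
  move=> s /=; rewrite in_itv /= => /andP[? ?]; apply: sub => /=.
  by rewrite ltr_norml; apply/andP; split; lra.
have St : S1 t by apply: (time_change_is_interval TC Sa Sb); lra.
split => //; near=> s; apply: subz; rewrite /= in_itv /=; apply/andP; split.
- apply: ltW; near: s; apply: lt_nbhsr; rewrite (time_change_ltE TC)//; lra.
- apply: ltW; near: s; apply: lt_nbhsl; rewrite (time_change_ltE TC)//; lra.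
Unshelve. all: by end_near. Qed.

(** Velocities get multiplied by the derivative of the change of time.
    The time 0, where that derivative is not two-sided, joins the exceptional
    null set of the flow condition. *)
Lemma solution_retime (X U : normedModType R) (H1 H2 : hybrid_system X U)
    S1 S2 th ka (dth : R -> R) (p : hfun R X * hfun R U) :
  time_change S1 S2 th ka ->
  (forall t, S1 t -> 0 < t -> is_derive t 1 th (dth t)) ->
  flow_set H1 = flow_set H2 -> jump_set H1 = jump_set H2 ->
  jump_map H1 = jump_map H2 ->
  (forall t j v, S1 t -> hdom p.1 (th t, j) ->
     flow_map H2 (hval p.1 j (th t)) (hval p.2 j (th t)) v ->
     flow_map H1 (hval p.1 j (th t)) (hval p.2 j (th t)) (dth t *: v)) ->
  (forall r, hdom p.1 r -> S2 r.1) ->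
  solution_pair H2 p ->
  solution_pair H1 (retime S1 th p.1, retime S1 th p.2).
Proof.
case: p => z u /= TC Dth EC ED EG flowE zS.
move=> [/= arc inp dom [init0 init] fset fmap jump].
have uS r : hdom u r -> S2 r.1 by rewrite -dom; exact: zS.
have C := time_change_clock TC; have [S0 th0] := clock0 C.
split => /=.
- exact: hybrid_arc_retime TC zS arc.
- exact: hybrid_input_retime TC uS inp.
- apply/seteqP; split => -[t j] /hdom_retime[St d]; apply/hdom_retime.
    by rewrite -dom.
  by rewrite dom.
- by rewrite !hval_retime// th0 EC ED; split => //; apply/hdom_retime; rewrite th0.
- move=> j t It; have [St Izt] := interior_retime TC zS It.
  by rewrite EC !hval_retime//; exact: fset.
- move=> j [t0 It0]; have [St0 Izt0] := interior_retime TC zS It0.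
  have /(negligible_time_change TC) N0 := fmap j (ex_intro _ _ Izt0).
  have n0 : (@lebesgue_measure R).-negligible [set 0].
    by apply/negligibleP; [exact: measurable_set1|exact: lebesgue_measure_set1].
  apply: negligibleS (negligibleU n0 N0) => t /= /not_implyP[/hdom_retime[St zt] Ht].
  have [->|tn0] := eqVneq t 0; [by left|right].
  have t0' : 0 < t by rewrite lt_def tn0 (clock_ge0 C St).
  split => // /(_ zt)[v Fv Dv]; apply: Ht; exists (dth t *: v).
    by rewrite !hval_retime//; exact: flowE.
  apply: (near_eq_is_derive (f := hval z j \o th)).
  + near=> w; rewrite hval_retime//; near: w; exact: (time_change_near TC St t0').
  + by apply: is_derive_comp_scale => //; exact: Dth.
- move=> j t /hdom_retime[St zt] /hdom_retime[_ zt'].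
  by rewrite ED EG !hval_retime//; exact: jump.
Unshelve. all: by end_near. Qed.

End TimeChange.

(** * Two clocks driven by the same gain *)

Section Clocks.
Context {R : realType}.

Definition clock_range (g : R -> R) (c : R) : set R :=
  [set t | exists2 x, c <= x & t = g x - g c].

Lemma derive_pos_lt (f f' : R -> R) :
  (forall x : R, 1 <= x -> is_derive x 1 f (f' x)) ->
  (forall x : R, 1 <= x -> 0 < f' x) ->
  forall x y, 1 <= x -> x < y -> f x < f y.
Proof.
move=> Df f'0 x y x1 xy.
have cf : {within `[x, y], continuous f}.
  apply: derivable_within_continuous => z; rewrite in_itv /= => /andP[xz _].
  by have [] := Df z (le_trans x1 xz).
have [z|z] := MVT xy _ cf (df := f').
  by rewrite in_itv /= => /andP[xz _]; apply: Df; lra.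
rewrite in_itv /= => /andP[xz _] fE.
by rewrite -subr_gt0 fE mulr_gt0 ?subr_gt0//; apply: f'0; lra.
Qed.

Lemma derive_pos_leE (f f' : R -> R) :
  (forall x : R, 1 <= x -> is_derive x 1 f (f' x)) ->
  (forall x : R, 1 <= x -> 0 < f' x) ->
  forall x y, 1 <= x -> 1 <= y -> (f x <= f y) = (x <= y).
Proof.
move=> Df f'0 x y x1 y1; have H := derive_pos_lt Df f'0.
have [xy|yx] := ltP y x.
  by apply/negbTE; rewrite -ltNge; exact: H.
by move: yx; rewrite le_eqVlt => /orP[/eqP->|/H-/(_ x1)/ltW//]; rewrite lexx.
Qed.

Lemma derive_pos_ltE (f f' : R -> R) :
  (forall x : R, 1 <= x -> is_derive x 1 f (f' x)) ->
  (forall x : R, 1 <= x -> 0 < f' x) ->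
  forall x y, 1 <= x -> 1 <= y -> (f x < f y) = (x < y).
Proof. by move=> Df f'0 x y x1 y1; rewrite !ltNge (derive_pos_leE Df f'0). Qed.

(** The gain that the clock f shows at time t, when it shows c at time 0. *)
Definition gain_at (f : R -> R) (c t : R) : R :=
  xget c [set x | c <= x /\ t = f x - f c].

Lemma gain_atE (f f' : R -> R) (c x : R) :
  (forall y : R, 1 <= y -> is_derive y 1 f (f' y)) ->
  (forall y : R, 1 <= y -> 0 < f' y) ->
  1 <= c -> c <= x -> gain_at f c (f x - f c) = x.
Proof.
move=> Df f'0 c1 cx; rewrite /gain_at; case: xgetP => [y _ [cy fy]|/(_ x)[]//].
have x1 := le_trans c1 cx; have y1 := le_trans c1 cy.
have fle := derive_pos_leE Df f'0.
apply/eqP; rewrite eq_le -(fle _ _ x1 y1) -(fle _ _ y1 x1).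
by apply/andP; split; lra.
Qed.

Section Pair.
Context (g h g' h' th : R -> R) (c : R).
Hypothesis c1 : 1 <= c.
Hypothesis Dg : forall x : R, 1 <= x -> is_derive x 1 g (g' x).
Hypothesis Dh : forall x : R, 1 <= x -> is_derive x 1 h (h' x).
Hypothesis g'0 : forall x : R, 1 <= x -> 0 < g' x.
Hypothesis h'0 : forall x : R, 1 <= x -> 0 < h' x.
Hypothesis thE : forall x : R, c <= x -> th (g x - g c) = h x - h c.

(** The derivative of h - K * g is nonpositive for 1 <= x <= M. *)
Lemma primitive_lipschitz (K M : R) :
  (forall x : R, 1 <= x -> x <= M -> h' x <= K * g' x) ->
  forall x y, 1 <= x -> x <= y -> y <= M -> h y - h x <= K * (g y - g x).
Proof.
move=> hKg x y x1 xy yM.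
pose f z := h z - K * g z; pose f' z := h' z - K * g' z.
have Df (z : R) : 1 <= z -> is_derive z 1 f (f' z).
  move=> z1; have Dgz := Dg z1; have Dhz := Dh z1.
  by apply: is_deriveB.
have cf : {within `[x, y], continuous f}.
  apply: derivable_within_continuous => z; rewrite in_itv /= => /andP[xz _].
  by have [] := Df z (le_trans x1 xz).
have [z|z] := MVT_segment xy _ cf (df := f').
  by rewrite in_itv /= => /andP[xz _]; apply: Df; lra.
rewrite in_itv /= => /andP[xz zy] fE.
have f'z : f' z <= 0 by rewrite subr_le0; apply: hKg; lra.
have : f y - f x <= 0 by rewrite fE mulr_le0_ge0// subr_ge0.
rewrite /f; lra.
Qed.

Lemma clock_range_IVT s x : c <= x -> 0 <= s -> s <= g x - g c ->
  exists2 y, c <= y <= x & s = g y - g c.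
Proof.
move=> cx s0 sx.
have cg : {within `[c, x], continuous g}.
  apply: derivable_within_continuous => z; rewrite in_itv /= => /andP[xz _].
  by have [] := Dg (le_trans c1 xz).
have gcx : g c <= g x by lra.
have [|y yI gy] := IVT (v := s + g c) cx cg.
  by rewrite (min_idPl gcx) (max_idPr gcx); apply/andP; split; lra.
by exists y; [move: yI; rewrite in_itv|rewrite gy addrK].
Qed.

(** th is h composed with the inverse of g, up to constants. *)
Lemma is_derive_clock (x : R) : c < x -> is_derive (g x - g c) 1 th (h' x / g' x).
Proof.
move=> cx; have x1 : 1 <= x := le_trans c1 (ltW cx).
pose G := gain_at g c.
have GK y : c <= y -> G (g y - g c) = y by exact: gain_atE Dg g'0 c1.
have nearx : \forall y \near x, c < y by exact: lt_nbhsr.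
have DG : is_derive (g x - g c) 1 G (g' x)^-1.
  apply: (@is_derive_inverse R (fun y => g y - g c)).
  - by near=> y; rewrite GK//; apply: ltW; near: y.
  - near=> y; have y1 : 1 <= y.
      by apply: (le_trans c1); apply: ltW; near: y.
    have [dgy _] := Dg y1.
    apply: continuousB; last exact: cst_continuous.
    by apply: differentiable_continuous; exact/derivable1_diffP.
  - have Dgx := Dg x1.
    by rewrite -[g' x]subr0; apply: is_deriveB.
  - by rewrite gt_eqF// g'0.
have Dth' : is_derive (g x - g c) 1 (fun t => h (G t) - h c) (h' x / g' x).
  rewrite -[h' x / g' x]subr0; apply: is_deriveB.
  by apply: is_derive1_comp; rewrite GK ?(ltW cx)//; exact: Dh.
apply: near_eq_is_derive Dth'.
have gx0 : 0 < g x - g c by rewrite subr_gt0 (derive_pos_ltE Dg g'0).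
have gx1 : g x - g c < g (x + 1) - g c.
  by rewrite ltrD2r (derive_pos_ltE Dg g'0)//; have := c1; lra.
near=> t.
have [] := @clock_range_IVT t (x + 1).
- by lra.
- by apply: ltW; near: t; exact: lt_nbhsr.
- by apply: ltW; near: t; exact: lt_nbhsl.
by move=> y /andP[cy _] ->; rewrite GK// thE.
Unshelve. all: by end_near. Qed.

Lemma clock_map_range :
  (forall M, 1 <= M -> exists2 K, 0 < K &
     forall x : R, 1 <= x -> x <= M -> h' x <= K * g' x) ->
  clock_map (clock_range g c) (clock_range h c) th.
Proof.
move=> hK.
have gle := derive_pos_leE Dg g'0.
have one_le_c := c1.
have clock_range_ge0 t : clock_range g c t -> 0 <= t.
  by move=> [x cx ->]; rewrite subr_ge0 gle//; lra.
split.
- by split; [exists c; rewrite ?subrr|rewrite -(subrr (g c)) thE ?subrr].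
- exact: clock_range_ge0.
- move=> s t s0 st [x cx tE].
  have [|y /andP[cy yx] ->] := clock_range_IVT cx s0; first by rewrite -tE.
  by exists y.
- move=> _ [x cx ->]; exists (g (x + 1) - g c).
    by exists (x + 1) => //; lra.
  by rewrite ltrD2r (derive_pos_ltE Dg g'0); lra.
- exists (fun k => g (c + k%:R) - g c); first by move=> k; exists (c + k%:R); rewrite ?lerDl.
  move=> _ [x cx ->]; exists (Num.Def.archi_bound (x - c)).
  have := archi_boundP (_ : 0 <= x - c); rewrite subr_ge0 => /(_ cx) xc.
  rewrite lerD2r gle//; [lra|lra|].
  by rewrite (le_trans c1)// lerDl.
- by move=> _ [x cx ->]; exists x; rewrite ?thE.
- move=> _ _ [x cx ->] [y cy ->]; rewrite !thE// !ltrD2r.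
  by rewrite (derive_pos_ltE Dg g'0) ?(derive_pos_ltE Dh h'0)//; lra.
- move=> _ [M cM ->]; have [K K0 KM] := hK M (le_trans c1 cM).
  exists K => // s t s0 st tb.
  have [y /andP[cy yM] tE] := clock_range_IVT cM (le_trans s0 st) tb.
  have [|x /andP[cx xy] sE] := clock_range_IVT cy s0; first by rewrite -tE.
  rewrite tE sE !thE//.
  have := @primitive_lipschitz K M KM x y; lra.
Qed.

End Pair.
End Clocks.

(** * The gain along solutions *)

Section GainAlongSolutions.
Context {R : realType}.

(** A point of a hybrid time domain is reached from (0, 0) by finitely many
    flow intervals and jumps. *)
Lemma hybrid_time_domain_ind (E : set (R * nat)) (Q : R -> nat -> Prop) :
  hybrid_time_domain E ->
  (E (0, 0%N) -> Q 0 0%N) ->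
  (forall j a b, a <= b -> (forall t, a <= t <= b -> E (t, j)) ->
     Q a j -> Q b j) ->
  (forall j t, E (t, j) -> E (t, j.+1) -> Q t j -> Q t j.+1) ->
  forall t j, E (t, j) -> Q t j.
Proof.
move=> [E0 Etrunc] Q0 Qflow Qjump T J' ETJ.
have [J [t [t0 tmono tE]]] := Etrunc _ ETJ.
have tEj j s : (j < J)%N -> t j <= s <= t j.+1 -> E (s, j).
  move=> jJ sj.
  by have [] : (E `&` [set r | 0 <= r.1 <= T /\ (r.2 <= J')%N]) (s, j) by rewrite tE.
have Qt j : (j < J)%N -> Q (t j) j.
  elim: j => [|j IH] jJ.
    rewrite t0; apply: Q0; rewrite -t0.
    by apply: tEj => //; rewrite lexx tmono.
  have jJ' := ltnW jJ.
  apply: Qjump.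
  - by apply: tEj => //; rewrite lexx tmono.
  - by apply: tEj => //; rewrite lexx tmono.
  - by apply: Qflow (IH jJ'); [exact: tmono|move=> s; exact: tEj].
have : [set p | (p.2 < J)%N /\ t p.2 <= p.1 <= t p.2.+1] (T, J').
  by rewrite -tE; split => //=; rewrite lexx (E0 _ ETJ).
move=> /= [JJ /andP[tT Tt]].
apply: Qflow (Qt _ JJ) => // s /andP[ts sT]; apply: tEj => //.
by rewrite ts (le_trans sT).
Qed.

Lemma is_derive_snd (V W : normedModType R) (f : R -> V * W) (t : R) (v : V * W) :
  is_derive t 1 f v -> is_derive t 1 (fun s => (f s).2) v.2.
Proof.
move=> [df dfE]; have fv : h^-1 *: (f (h *: 1 + t) - f t) @[h --> 0^'] --> v.
  by rewrite -dfE; exact: df.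
have sv : h^-1 *: ((f (h *: 1 + t)).2 - (f t).2) @[h --> (0 : R)^'] --> v.2.
  exact: (cvg_comp _ _ fv cvg_snd).
split; first by apply/cvg_ex; exists v.2.
exact/cvg_lim.
Qed.

Lemma norm_snd (V W : normedModType R) (z : V * W) : `|z.2| <= `|z|.
Proof. by rewrite prod_normE le_max lexx orbT. Qed.

Context {n qbar : nat} (P : problem_data R n qbar).

(** An initial state lies in the jump set or in the closure of the flow
    set, and the bound on the gain is a closed condition. *)
Lemma init_gain_ge1 (H : hybrid_system zstate (input P))
    (p : hfun R zstate * hfun R (input P)) :
  flow_set H = C_z P `*` [set: input P] -> jump_set H = D_z P `*` [set: input P] ->
  solution_pair H p -> 1 <= init_gain p.1.
Proof.
move=> HC HD S; have [_] := sol_init S; rewrite HC HD /init_gain => -[clo|]; last first.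
  by move=> [[_ /= +] _]; rewrite in_itv /= andbT.
rewrite leNgt; apply/negP => lt1.
set r := (X in closure _ X) in clo.
have cnt : (fun q : zstate * input P => q.1.2) q @[q --> r] --> r.1.2.
  by apply: cvg_comp; [exact: cvg_fst|exact: cvg_snd].
have nr : \forall q \near r, q.1.2 < 1.
  exact: (cnt _ (lt_nbhsl lt1)).
have [q [[[_ /= q1] _] q2]] := clo _ nr.
by move: q1; rewrite in_itv /= andbT leNgt q2.
Qed.

(** If f is a primitive of the reciprocal of the speed of the gain, then f of
    the gain has derivative 1 almost everywhere on flows, and jumps do not
    change the gain.  The lower bound on the gain belongs to the same
    induction, because f is only controlled above 1. *)
Lemma gain_equation (H : hybrid_system zstate (input P))
    (p : hfun R zstate * hfun R (input P)) (f f' : R -> R) (L : R) :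
  0 < L ->
  (forall x : R, 1 <= x -> is_derive x 1 f (f' x)) ->
  (forall x y, 1 <= x -> x <= y -> 0 <= f y - f x <= L * (y - x)) ->
  flow_set H = C_z P `*` [set: input P] -> jump_set H = D_z P `*` [set: input P] ->
  jump_map H = @G_z R n qbar P ->
  (forall (z v : zstate) u, 1 <= z.2 -> flow_map H z u v -> f' z.2 * v.2 = 1) ->
  solution_pair H p ->
  forall t j, hdom p.1 (t, j) ->
    1 <= (hval p.1 j t).2 /\ f (hval p.1 j t).2 = f (init_gain p.1) + t.
Proof.
move=> L0 Df lipf HC HD HG flowE S.
have := init_gain_ge1 HC HD S.
have [htd zAC] := sol_arc S; move: p S htd zAC => [z u] S /= htd zAC c1.
apply: (hybrid_time_domain_ind htd).
- by rewrite addr0.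
- move=> j a b ab sub [mua fa].
  have [<-//|a_lt_b] := eqVneq a b.
  have {}a_lt_b : a < b by rewrite lt_def eq_sym a_lt_b.
  pose m t := (hval z j t).2.
  have subz : `[a, b]%classic `<=` hslice z j.
    by move=> t /=; rewrite in_itv; exact: sub.
  have zACm : abs_continuous a b m.
    apply: (@abs_continuous_lipschitz _ _ _ _ _ 1 (hval z j) snd) => //.
      by move=> s t _ _ _; rewrite mul1r; exact: norm_snd (hval z j t - hval z j s).
    exact: zAC.
  have int t : a < t < b -> (hslice z j)° t.
    move=> /andP[a_t t_b].
    near=> w; apply: subz; rewrite /= in_itv /=.
    apply/andP; split; apply: ltW; near: w; [exact: lt_nbhsr|exact: lt_nbhsl].
  have m_int t : a < t < b -> 1 <= m t.
    move=> /int /(sol_flow_set S); rewrite HC /= => -[[_ /= +] _].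
    by rewrite in_itv /= andbT.
  (* The flow set only constrains interior times: the end point follows by
     continuity. *)
  have mb : 1 <= m b.
    rewrite leNgt; apply/negP => mb1.
    have mb1' : 0 < 1 - m b by rewrite subr_gt0.
    have [d d0 Hd] := abs_continuous_dist zACm mb1'.
    pose t := Num.max ((a + b) / 2) (b - d / 2).
    have [at_ tb btd] : [/\ a < t, t < b & b - t < d].
      split; rewrite /t ?lt_max ?gt_max.
      - by apply/orP; left; lra.
      - by apply/andP; split; lra.
      - by rewrite ltrBlDl -ltrBlDr lt_max; apply/orP; right; lra.
    have := Hd t b (ltW at_) (ltW tb) (lexx b) btd.
    rewrite ltr_norml => /andP[+ _].
    by have := m_int t; rewrite at_ tb => /(_ isT); lra.
  have m1 t : a <= t <= b -> 1 <= m t.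
    move=> /andP[a_t t_b]; have [<-//|ta] := eqVneq a t.
    have [->//|tb] := eqVneq t b.
    by apply: m_int; rewrite !lt_def eq_sym ta eq_sym tb a_t t_b.
  split; first exact: mb.
  have lipm s t : a <= s -> s <= t -> t <= b ->
      `|f (m t) - f (m s)| <= L * `|m t - m s|.
    move=> as_ st tb.
    have ms1 : 1 <= m s by apply: m1; rewrite as_ (le_trans st).
    have mt1 : 1 <= m t by apply: m1; rewrite tb (le_trans as_).
    have [mst|mts] := leP (m s) (m t).
      have /andP[f0 fL] := lipf _ _ ms1 mst.
      by rewrite !ger0_norm// subr_ge0.
    have /andP[f0 fL] := lipf _ _ mt1 (ltW mts).
    by rewrite distrC (distrC (m t)) !ger0_norm// subr_ge0 ltW.
  have zACfm := abs_continuous_lipschitz L0 lipm zACm.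
  have [|N [mN N0 subN]] := sol_flow_map S (j := j).
    by exists ((a + b) / 2); apply: int; apply/andP; split; lra.
  have Dfm : {ae lebesgue_measure,
      forall t : R, a <= t <= b -> is_derive t 1 (f \o m) 1}.
    exists N; split => // t /= /not_implyP[tab ND]; apply: subN => /= Hz.
    have [v Fv Dv] := Hz (sub _ tab); apply: ND.
    rewrite -[X in is_derive _ _ _ X](flowE _ _ _ (m1 _ tab) Fv).
    apply: is_derive1_comp; last exact: is_derive_snd.
    exact: Df (m1 _ tab).
  have := abs_continuous_constant_derive ab zACfm Dfm.
  by rewrite /= mul1r -/(m b) => fmb; move: fa; rewrite -/(m a); lra.
- move=> j t zt zt' [mu1 fmu]; have [_] := sol_jump S zt zt'.
  rewrite HG /=.
  case: (hval z j t) mu1 fmu => -[[th y] tau] mu /= mu1 fmu.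
  by move=> [[[_ _] _] ->].
Unshelve. all: by end_near. Qed.

End GainAlongSolutions.

(** * Explicit clocks of the three gain laws *)

(** What the bijection needs to know about the gain law: g is the clock of
    the nominal system, which stops at the horizon; h is the clock of the
    target system, which runs forever; and the dilation matches them.  The
    lower bound on the rate makes both clocks Lipschitz with constant ups. *)
Record gain_primitives (R : realType) (ups : R) (l : \bar R) (g h : R -> R) :
    Prop := GainPrimitives {
  rate_ge : forall x : R, 1 <= x -> x / ups <= gain_rate ups l x ;
  derive_gprim : forall x : R, 1 <= x -> is_derive x 1 g (gain_rate ups l x)^-1 ;
  derive_hprim : forall x : R, 1 <= x -> is_derive x 1 h (x / gain_rate ups l x) ;
  gprim_onto : forall c t : R, 1 <= c -> 0 <= t -> (t%:E < horizon ups l c)%E ->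
    clock_range g c t ;
  gprim_lt : forall c x : R, 1 <= c -> c <= x ->
    ((g x - g c)%:E < horizon ups l c)%E ;
  hprim_onto : forall c s : R, 1 <= c -> 0 <= s -> clock_range h c s ;
  dilation_prim : forall c x : R, 1 <= c -> c <= x ->
    dilation ups l c (g x - g c) = h x - h c }.

Section ExplicitPrimitives.
Context {R : realType}.
Implicit Types ups c x t s r : R.

Lemma gain_primitives1 ups : 0 < ups ->
  gain_primitives ups 1%:E (fun x => ups * ln x) (fun x => ups * x).
Proof.
move=> ups0; have upsN0 : ups != 0 by rewrite gt_eqF.
split; rewrite /gain_rate /horizon /dilation /= ?eqxx //.
- move=> x x1; have x0 : 0 < x by lra.
  rewrite invf_div; have := is_derive1_ln x0; exact: is_deriveZ.
- move=> x x1; have x0 : 0 < x by lra.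
  have -> : x / (x / ups) = ups * 1 by field; rewrite upsN0 gt_eqF.
  exact: is_deriveZ.
- move=> c t c1 t0 _; have c0 : 0 < c by lra.
  exists (c * expR (t / ups)).
    by apply: ler_peMr; [exact: ltW|rewrite -[leLHS]expR0 ler_expR divr_ge0// ltW].
  rewrite lnM ?posrE ?expR_gt0// expRK; field.
  by rewrite upsN0.
- by move=> *; rewrite ltry.
- move=> c s c1 s0; exists (c + s / ups); first by rewrite lerDl divr_ge0// ltW.
  by field.
- move=> c x c1 cx; have c0 : 0 < c by lra.
  have x0 : 0 < x by lra.
  have -> : (ups * ln x - ups * ln c) / ups = ln x - ln c by field.
  rewrite expRB !lnK ?posrE//; field.
  by rewrite gt_eqF.
Qed.

Lemma gain_primitivesy ups : 0 < ups ->
  gain_primitives ups +oo%E (fun x => - ups * x^-1) (fun x => ups * ln x).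
Proof.
move=> ups0; have upsN0 : ups != 0 by rewrite gt_eqF.
split; rewrite /gain_rate /horizon /dilation /=.
- by move=> x x1; rewrite ler_pM2r ?invr_gt0// expr2 ler_peMl//; lra.
- move=> x x1; have x0 : x != 0 by rewrite gt_eqF//; lra.
  have -> : (x ^+ 2 / ups)^-1 = - ups * (- x ^- 2) by rewrite invf_div mulrNN.
  apply: is_deriveZ.
  have := @is_deriveV R id x 1 1 x0 (is_derive_id (x : R^o) 1).
  by rewrite /GRing.scale /= mulr1.
- move=> x x1; have x0 : 0 < x by lra.
  have -> : x / (x ^+ 2 / ups) = ups * x^-1 by field; rewrite upsN0 gt_eqF.
  have := is_derive1_ln x0; exact: is_deriveZ.
- move=> c t c1 t0; rewrite lte_fin => tc; have c0 : 0 < c by lra.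
  have d0 : 0 < ups / c - t by lra.
  exists (ups / (ups / c - t)).
    rewrite ler_pdivlMr// mulrBr mulrCA divff ?gt_eqF// mulr1 gerBl.
    by rewrite mulr_ge0// ltW.
  by rewrite invf_div; field; rewrite upsN0 gt_eqF.
- move=> c x c1 cx; rewrite lte_fin.
  have : 0 < ups / x by rewrite divr_gt0//; lra.
  by rewrite !mulNr; lra.
- move=> c s c1 s0; have c0 : 0 < c by lra.
  exists (c * expR (s / ups)).
    by apply: ler_peMr; [exact: ltW|rewrite -[leLHS]expR0 ler_expR divr_ge0// ltW].
  rewrite lnM ?posrE ?expR_gt0// expRK; field.
  by rewrite upsN0.
- move=> c x c1 cx; have c0 : 0 < c by lra.
  have x0 : 0 < x by lra.
  have -> : ups - c * (- ups * x^-1 - - ups * c^-1) = ups * c / x.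
    by field; rewrite ?(gt_eqF c0) ?(gt_eqF x0).
  have -> : ups / (ups * c / x) = x / c.
    by field; rewrite ?upsN0 ?(gt_eqF c0) ?(gt_eqF x0).
  by rewrite ln_div ?posrE// mulrBr.
Qed.

Lemma gain_primitives_gt1 ups r : 0 < ups -> 1 < r ->
  gain_primitives ups r%:E (fun x => - ups * x `^ (r^-1 - 1))
                           (fun x => (r - 1) * ups * x `^ r^-1).
Proof.
move=> ups0 r1; have upsN0 : ups != 0 by rewrite gt_eqF.
have r0 : 0 < r by lra.
have rN0 : r != 0 by rewrite gt_eqF.
have rm0 : 0 < r - 1 by lra.
have rmN0 : r - 1 != 0 by rewrite gt_eqF.
have rV1 : r^-1 < 1 by rewrite invf_lt1.
have rV0 : 0 < r^-1 by rewrite invr_gt0.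
have eE : (1 - r) / r = r^-1 - 1 by field.
have e0 : r^-1 - 1 < 0 by lra.
have FV x : 1 <= x -> (r / (r - 1) * (x `^ (2 - r^-1) / ups))^-1 =
    (r - 1) / r * ups * x `^ (r^-1 - 1 - 1).
  move=> x1; rewrite invfM invf_div (invf_div (x `^ _)).
  have -> : r^-1 - 1 - 1 = - (2 - r^-1) by lra.
  by rewrite powRN mulrA.
split; rewrite /gain_rate /horizon /dilation /= ?(gt_eqF r1) ?eE.
- move=> x x1; rewrite mulrA ler_pM2r ?invr_gt0//.
  apply: (@le_trans _ _ (x `^ (2 - r^-1))); first by apply: le1r_powR; lra.
  by rewrite ler_peMl ?powR_ge0// ler_pdivlMr//; lra.
- move=> x x1; rewrite (FV _ x1); have x0 : 0 < x by lra.
  have -> : (r - 1) / r * ups * x `^ (r^-1 - 1 - 1) =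
     - ups * ((r^-1 - 1) * x `^ (r^-1 - 1 - 1)) by field.
  have := is_derive1_powR (r^-1 - 1) x0; exact: is_deriveZ.
- move=> x x1; rewrite (FV _ x1); have x0 : 0 < x by lra.
  have -> : x * ((r - 1) / r * ups * x `^ (r^-1 - 1 - 1)) =
     (r - 1) * ups * (r^-1 * x `^ (r^-1 - 1)).
    rewrite [in LHS]powRB ?powRr1 ?ltW//; last by rewrite (gt_eqF x0) implybT.
    by field; rewrite rN0 gt_eqF.
  have := is_derive1_powR r^-1 x0; exact: is_deriveZ.
- move=> c t c1 t0; rewrite lte_fin => tc; have c0 : 0 < c by lra.
  have y0 : 0 < c `^ (r^-1 - 1) - t / ups.
    by rewrite subr_gt0 ltr_pdivrMr// mulrC.
  have eN0 : r^-1 - 1 != 0 by rewrite lt_eqF.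
  exists ((c `^ (r^-1 - 1) - t / ups) `^ (r^-1 - 1)^-1).
    rewrite -ler_ln ?posrE ?powR_gt0// ln_powR.
    rewrite -[leLHS](@mulKf _ (r^-1 - 1)) // -(ln_powR c).
    rewrite ler_nM2l ?invr_lt0// ler_ln ?posrE ?powR_gt0//.
    by rewrite gerBl divr_ge0// ltW.
  rewrite -powRrM mulVf// powRr1 ?ltW//; field.
  by rewrite upsN0.
- move=> c x c1 cx; rewrite lte_fin.
  have : 0 < ups * x `^ (r^-1 - 1) by rewrite mulr_gt0// powR_gt0//; lra.
  by rewrite !mulNr; lra.
- move=> c s c1 s0; have c0 : 0 < c by lra.
  have k0 : 0 < (r - 1) * ups by rewrite mulr_gt0.
  have w0 : 0 <= s / ((r - 1) * ups) by rewrite divr_ge0// ltW.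
  have cr0 := powR_gt0 r^-1 c0.
  exists ((c `^ r^-1 + s / ((r - 1) * ups)) `^ r).
    have -> : (c <= (c `^ r^-1 + s / ((r - 1) * ups)) `^ r) =
        ((c `^ r^-1) `^ r <= (c `^ r^-1 + s / ((r - 1) * ups)) `^ r).
      by rewrite -[in RHS]powRrM mulVf// powRr1// ltW.
    by apply: ge0_ler_powR; rewrite ?nnegrE ?addr_ge0 ?lerDl// ltW.
  rewrite -powRrM mulfV// powRr1; last by apply: addr_ge0; first exact: ltW.
  by field; rewrite rmN0 upsN0.
- move=> c x c1 cx; have c0 : 0 < c by lra.
  have x0 : 0 < x by lra.
  have -> : ups * c `^ (r^-1 - 1) - (- ups * x `^ (r^-1 - 1) - - ups * c `^ (r^-1 - 1))
     = ups * x `^ (r^-1 - 1) by ring.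
  rewrite powRM ?powR_ge0 ?ltW// -powRrM.
  have -> : (r^-1 - 1) * (1 - r)^-1 = r^-1.
    by field; rewrite rN0 lt_eqF//; lra.
  have -> : (1 - r)^-1 = - (r - 1)^-1 by rewrite -invrN opprB.
  rewrite powRN mulrA mulfV ?gt_eqF ?powR_gt0// mul1r.
  by ring.
Qed.

Lemma gain_primitives_exist ups (l : \bar R) : 0 < ups -> (1 <= l)%E ->
  exists g h, gain_primitives ups l g h.
Proof.
move=> ups0; case: l => [r| |].
- rewrite lee_fin le_eqVlt => /orP[/eqP<-|r1].
    by do 2 eexists; exact: gain_primitives1.
  by do 2 eexists; exact: gain_primitives_gt1.
- by move=> _; do 2 eexists; exact: gain_primitivesy.
- by rewrite leeNy_eq.
Qed.

End ExplicitPrimitives.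

(** * The bijection between maximal solutions *)

Section MaximalPairs.
Context {R : realType}.

(** An extension of w p would pull back through w' to an extension of p. *)
Lemma set_bij_maximal (X1 U1 X2 U2 : normedModType R)
    (H1 : hybrid_system X1 U1) (H2 : hybrid_system X2 U2)
    (w : hfun R X1 * hfun R U1 -> hfun R X2 * hfun R U2)
    (w' : hfun R X2 * hfun R U2 -> hfun R X1 * hfun R U1) :
  (forall p, solution_pair H1 p -> solution_pair H2 (w p)) ->
  (forall q, solution_pair H2 q -> solution_pair H1 (w' q)) ->
  (forall p, solution_pair H1 p -> w' (w p) = p) ->
  (forall q, solution_pair H2 q -> w (w' q) = q) ->
  (forall p p', solution_pair H1 p -> solution_pair H1 p' ->
     extends p p' -> extends (w p) (w p')) ->
  (forall q q', solution_pair H2 q -> solution_pair H2 q' ->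
     extends q q' -> extends (w' q) (w' q')) ->
  set_bij (maximal_solution_pairs H1) (maximal_solution_pairs H2) w.
Proof.
move=> ws w's wK w'K wE w'E; split.
- move=> p [Sp maxp]; split; first exact: ws.
  move=> [q [Sq pq]]; apply: maxp; exists (w' q); split; first exact: w's.
  by rewrite -(wK p Sp); apply: w'E => //; exact: ws.
- move=> p p'; rewrite !inE => -[Sp _] [Sp' _] ww.
  by rewrite -(wK p Sp) ww wK.
- move=> q [Sq maxq]; exists (w' q); last exact: w'K.
  split; first exact: w's.
  move=> [p [Sp qp]]; apply: maxq; exists (w p); split; first exact: ws.
  by rewrite -(w'K q Sq); apply: wE => //; exact: w's.
Qed.

Lemma extends_retime (X U : normedModType R) S1 S2 (th ka : R -> R)
    (p p' : hfun R X * hfun R U) :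
  time_change S1 S2 th ka -> (forall r, hdom p'.1 r -> S2 r.1) ->
  extends p p' ->
  extends (retime S1 th p.1, retime S1 th p.2)
          (retime S1 th p'.1, retime S1 th p'.2).
Proof.
move=> TC pS [[sub nsub] E1 E2]; split => /=.
- split; first by move=> [t j] /hdom_retime[St zt]; apply/hdom_retime; split => //; exact: sub.
  move=> sub'; apply: nsub => -[s j] zs.
  have Ss := pS _ zs; have Sk := clock_maps (time_change_clockV TC) Ss.
  have /sub' : hdom (retime S1 th p'.1) (ka s, j).
    by apply/hdom_retime; rewrite (time_changeVK TC).
  by move=> /hdom_retime[_]; rewrite (time_changeVK TC).
- by move=> [t j] /hdom_retime[St zt]; rewrite !retimeE// E1.
- by move=> [t j] /hdom_retime[St zt]; rewrite !retimeE// E2.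
Qed.

Lemma extends_init_gain (n : nat) (U : normedModType R)
    (p p' : hfun R (@zstate R n) * hfun R U) :
  hdom p.1 (0, 0%N) -> extends p p' -> init_gain p'.1 = init_gain p.1.
Proof. by move=> p0 [_ E _]; rewrite /init_gain /hval E. Qed.

End MaximalPairs.

Section Dilation.
Context {R : realType} {n qbar : nat}.
Variables (P : problem_data R n qbar) (ups : R) (l : \bar R) (g h : R -> R).
Hypothesis ups0 : 0 < ups.
Hypothesis GP : gain_primitives ups l g h.
Local Notation F := (gain_rate ups l).
Local Notation arcs := (hfun R (@zstate R n) * hfun R (input P))%type.

Let Dg := derive_gprim GP.
Let Dh := derive_hprim GP.

Lemma gain_rate_gt0 (x : R) : 1 <= x -> 0 < F x.
Proof.
move=> x1; apply: lt_le_trans (rate_ge GP x1).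
by rewrite divr_gt0//; lra.
Qed.

Let g'0 (x : R) : 1 <= x -> 0 < (F x)^-1.
Proof. by move=> x1; rewrite invr_gt0 gain_rate_gt0. Qed.

Let h'0 (x : R) : 1 <= x -> 0 < x / F x.
Proof. by move=> x1; rewrite divr_gt0 ?gain_rate_gt0//; lra. Qed.

Lemma hprim_slope_le (x : R) : 1 <= x -> x / F x <= ups.
Proof.
move=> x1; rewrite ler_pdivrMr ?gain_rate_gt0// mulrC -ler_pdivrMr//.
exact: (rate_ge GP).
Qed.

Lemma gprim_slope_le (x : R) : 1 <= x -> (F x)^-1 <= x / F x.
Proof. by move=> x1; rewrite ler_peMl// ltW// g'0. Qed.

(** The inverse of the dilation, written with the two clocks exchanged. *)
Definition contraction (c s : R) : R := g (gain_at h c s) - g c.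

Lemma contractionE (c x : R) : 1 <= c -> c <= x ->
  contraction c (h x - h c) = g x - g c.
Proof. by move=> c1 cx; rewrite /contraction (gain_atE Dh h'0). Qed.

(** Since h' = x * g', the dilation is Lipschitz with constant M as long
    as the gain x stays below M; its inverse has constant 1, because x >= 1. *)
Lemma dilation_time_change (c : R) : 1 <= c ->
  time_change (clock_range g c) (clock_range h c) (dilation ups l c) (contraction c).
Proof.
move=> c1; split.
- apply: (clock_map_range c1 Dg Dh g'0 h'0); first by
    move=> x cx; exact: (dilation_prim GP).
  move=> M M1; exists M; first by lra.
  by move=> x x1 xM; apply: ler_wpM2r => //; rewrite ltW// g'0.
- apply: (clock_map_range c1 Dh Dg h'0 g'0); first by move=> x cx; exact: contractionE.
  by move=> M M1; exists 1 => // x x1 _; rewrite mul1r; exact: gprim_slope_le.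
- by move=> _ [x cx ->]; rewrite (dilation_prim GP)// contractionE.
- by move=> _ [x cx ->]; rewrite contractionE// (dilation_prim GP).
Qed.

Lemma is_derive_dilation (c t : R) : 1 <= c -> clock_range g c t -> 0 < t ->
  is_derive t 1 (dilation ups l c) (gain_at g c t).
Proof.
move=> c1 [x cx ->]; rewrite (gain_atE Dg g'0)// subr_gt0 => gcx.
have {}cx : c < x.
  by rewrite -(derive_pos_ltE Dg g'0) ?gcx//; lra.
have x1 : 1 <= x by lra.
have F0 := gain_rate_gt0 x1.
have {2}-> : x = x / F x / (F x)^-1 by field; rewrite gt_eqF.
apply: (is_derive_clock c1 Dg Dh g'0 _ cx) => y cy; exact: (dilation_prim GP).
Qed.

Lemma is_derive_contraction (c s : R) : 1 <= c -> clock_range h c s -> 0 < s ->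
  is_derive s 1 (contraction c) (gain_at h c s)^-1.
Proof.
move=> c1 [x cx ->]; rewrite (gain_atE Dh h'0)// subr_gt0 => hcx.
have {}cx : c < x.
  by rewrite -(derive_pos_ltE Dh h'0) ?hcx//; lra.
have x1 : 1 <= x by lra.
have F0 := gain_rate_gt0 x1.
have -> : x^-1 = (F x)^-1 / (x / F x) by field; rewrite !gt_eqF//; lra.
apply: (is_derive_clock c1 Dh Dg h'0 _ cx) => y cy; exact: contractionE.
Qed.

Lemma prim_lipschitz (f f' : R -> R) :
  (forall x : R, 1 <= x -> is_derive x 1 f (f' x)) ->
  (forall x : R, 1 <= x -> 0 < f' x) ->
  (forall x : R, 1 <= x -> f' x <= ups) ->
  forall x y : R, 1 <= x -> x <= y -> 0 <= f y - f x <= ups * (y - x).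
Proof.
move=> Df f'0 fL x y x1 xy; have y1 := le_trans x1 xy.
rewrite subr_ge0 (derive_pos_leE Df f'0)// xy /=.
apply: (@primitive_lipschitz R id f (fun=> 1) f' _ Df ups y) => //.
by move=> z z1 _; rewrite mulr1; exact: fL.
Qed.

Lemma nominal_gain (p : arcs) : solution_pair (nominal P ups l) p ->
  1 <= init_gain p.1 /\ forall t j, hdom p.1 (t, j) ->
    init_gain p.1 <= (hval p.1 j t).2 /\
    t = g (hval p.1 j t).2 - g (init_gain p.1).
Proof.
move=> S; have c1 : 1 <= init_gain p.1 by exact: init_gain_ge1 S.
split => // t j pt; have t0 : 0 <= t by have [[+ _] _] := sol_arc S; move/(_ _ pt).
have [||mu1 gmu] := gain_equation (H := nominal P ups l) ups0 Dg
  (prim_lipschitz Dg g'0 _)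
  (erefl _) (erefl _) (erefl _) _ S pt.
- by move=> x x1; exact: le_trans (gprim_slope_le x1) (hprim_slope_le x1).
- move=> [[x tau] mu] [[vx vtau] vmu] u /= mu1 [_ ->].
  by rewrite mulVf// gt_eqF// gain_rate_gt0.
by split; [rewrite -(derive_pos_leE Dg g'0)//; lra|lra].
Qed.

Lemma target_gain (p : arcs) : solution_pair (target P ups l) p ->
  1 <= init_gain p.1 /\ forall t j, hdom p.1 (t, j) ->
    init_gain p.1 <= (hval p.1 j t).2 /\
    t = h (hval p.1 j t).2 - h (init_gain p.1).
Proof.
move=> S; have c1 : 1 <= init_gain p.1 by exact: init_gain_ge1 S.
split => // t j pt; have t0 : 0 <= t by have [[+ _] _] := sol_arc S; move/(_ _ pt).
have [|mu1 gmu] := gain_equation (H := target P ups l) ups0 Dh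
  (prim_lipschitz Dh h'0 hprim_slope_le)
  (erefl _) (erefl _) (erefl _) _ S pt.
- move=> [[x tau] mu] [[vx vtau] vmu] u /= mu1 [_ ->].
  by rewrite mulrACA mulfV ?mul1r ?mulVf// gt_eqF ?gain_rate_gt0//; lra.
by split; [rewrite -(derive_pos_leE Dh h'0)//; lra|lra].
Qed.

Definition Winv (p : arcs) : arcs :=
  let c := init_gain p.1 in
  (retime (clock_range h c) (contraction c) p.1,
   retime (clock_range h c) (contraction c) p.2).

(** The domain of the dilation is the set of the nominal times at which the
    clock g shows some gain x >= c. *)
Lemma W_retime (p : arcs) : 1 <= init_gain p.1 ->
  W ups l p =
    (retime (clock_range g (init_gain p.1)) (dilation ups l (init_gain p.1)) p.1,
     retime (clock_range g (init_gain p.1)) (dilation ups l (init_gain p.1)) p.2).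
Proof.
move=> c1; have -> : clock_range g (init_gain p.1) =
    [set t | 0 <= t /\ (t%:E < horizon ups l (init_gain p.1))%E].
  apply/seteqP; split => t /=.
  - move=> [x cx ->]; split; last exact: (gprim_lt GP).
    by rewrite subr_ge0 (derive_pos_leE Dg g'0)//; lra.
  - by move=> [t0 tT]; exact: (gprim_onto GP).
by rewrite /W; congr (_, _); apply/funext => r; rewrite /retime /hdilation /=;
  case: ifP.
Qed.

(** The dilation has derivative x at the time when the clock g shows x,
    and x is also the gain of the solution at the matched time; multiplication
    by it turns a target velocity into a nominal one. *)
Lemma W_solution (p : arcs) :
  solution_pair (target P ups l) p -> solution_pair (nominal P ups l) (W ups l p).
Proof.
move=> S; have [c1 cE] := target_gain S; rewrite W_retime//.
have TC := dilation_time_change c1.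
apply: (solution_retime TC (dth := gain_at g (init_gain p.1))) S => //.
- by move=> t St t0; exact: is_derive_dilation.
- move=> t j v [x cx tE] pt; have [cmu muE] := cE _ _ pt.
  have -> : gain_at g (init_gain p.1) t =
      (hval p.1 j (dilation ups l (init_gain p.1) t)).2.
    rewrite tE (gain_atE Dg g'0)// (dilation_prim GP)//.
    rewrite tE (dilation_prim GP)// in cmu muE.
    move: cmu muE; set m := (hval _ _ _).2 => cmu muE.
    by rewrite -[LHS](gain_atE Dh h'0 c1 cx) muE (gain_atE Dh h'0).
  move: cmu; case: (hval p.1 j _) => -[y tau] mu /= cmu.
  have mu0 : mu != 0 by rewrite gt_eqF//; lra.
  case: v => -[vx vtau] vmu /= [[Fv ->] ->]; split; first split.
  + by exists vx.
  + exact: mulfV.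
  + exact: mulVKf.
- by move=> [t j] pt; have [cmu muE] := cE _ _ pt; exists (hval p.1 j t).2.
Qed.

Lemma Winv_solution (p : arcs) :
  solution_pair (nominal P ups l) p -> solution_pair (target P ups l) (Winv p).
Proof.
move=> S; have [c1 cE] := nominal_gain S.
have TC := time_change_sym (dilation_time_change c1).
apply: (solution_retime TC (dth := fun s => (gain_at h (init_gain p.1) s)^-1)) S => //.
- by move=> t St t0; exact: is_derive_contraction.
- move=> t j v [x cx tE] pt; have [cmu muE] := cE _ _ pt.
  have -> : gain_at h (init_gain p.1) t =
      (hval p.1 j (contraction (init_gain p.1) t)).2.
    rewrite tE (gain_atE Dh h'0)// contractionE//.
    rewrite tE contractionE// in cmu muE.
    move: cmu muE; set m := (hval _ _ _).2 => cmu muE.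
    by rewrite -[LHS](gain_atE Dg g'0 c1 cx) muE (gain_atE Dg g'0).
  move: cmu; case: (hval p.1 j _) => -[y tau] mu /= cmu.
  have mu0 : mu != 0 by rewrite gt_eqF//; lra.
  case: v => -[vx vtau] vmu /= [[[w Fw <-] ->] ->]; split; first split.
  + by rewrite /= scalerA mulVf// scale1r.
  + exact: mulr1.
  + by [].
- by move=> [t j] pt; have [cmu muE] := cE _ _ pt; exists (hval p.1 j t).2.
Qed.

Lemma init_gain_retime (S1 S2 : set R) (th : R -> R) (z : hfun R (@zstate R n)) :
  clock_map S1 S2 th -> init_gain (retime S1 th z) = init_gain z.
Proof. by move=> /clock0[S0 th0]; rewrite /init_gain hval_retime// th0. Qed.

Lemma target_dom (p : arcs) : solution_pair (target P ups l) p ->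
  (forall r, hdom p.1 r -> clock_range h (init_gain p.1) r.1) /\
  (forall r, hdom p.2 r -> clock_range h (init_gain p.1) r.1).
Proof.
move=> S; rewrite -(sol_dom S); have [_ cE] := target_gain S.
by split=> -[t j] /cE[cmu muE]; exists (hval p.1 j t).2.
Qed.

Lemma nominal_dom (p : arcs) : solution_pair (nominal P ups l) p ->
  (forall r, hdom p.1 r -> clock_range g (init_gain p.1) r.1) /\
  (forall r, hdom p.2 r -> clock_range g (init_gain p.1) r.1).
Proof.
move=> S; rewrite -(sol_dom S); have [_ cE] := nominal_gain S.
by split=> -[t j] /cE[cmu muE]; exists (hval p.1 j t).2.
Qed.

Lemma WK (p : arcs) : solution_pair (target P ups l) p -> Winv (W ups l p) = p.
Proof.
move=> S; have [c1 _] := target_gain S; have [dom1 dom2] := target_dom S.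
have TC := dilation_time_change c1.
rewrite W_retime// /Winv /= (init_gain_retime _ (time_change_clock TC)).
by rewrite !(retimeK TC)//; case: (p).
Qed.

Lemma WinvK (p : arcs) : solution_pair (nominal P ups l) p -> W ups l (Winv p) = p.
Proof.
move=> S; have [c1 _] := nominal_gain S; have [dom1 dom2] := nominal_dom S.
have TC := dilation_time_change c1.
have cE : init_gain (Winv p).1 = init_gain p.1.
  exact: init_gain_retime (time_change_clockV TC).
rewrite W_retime cE// /Winv /=.
by rewrite !(retimeK (time_change_sym TC))//; case: (p).
Qed.

Lemma W_bij : set_bij (maximal_solution_pairs (target P ups l))
  (maximal_solution_pairs (nominal P ups l)) (W ups l).
Proof.
apply: (set_bij_maximal W_solution Winv_solution WK WinvK).
- move=> p p' S S' pp'.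
  have [c1 _] := target_gain S; have [dom' _] := target_dom S'.
  have cE := extends_init_gain (proj1 (sol_init S)) pp'.
  rewrite cE in dom'.
  rewrite (W_retime c1) (W_retime (p := p')) cE//.
  exact: extends_retime (dilation_time_change c1) dom' pp'.
- move=> p p' S S' pp'.
  have [c1 _] := nominal_gain S; have [dom' _] := nominal_dom S'.
  have cE := extends_init_gain (proj1 (sol_init S)) pp'.
  rewrite cE in dom'; rewrite /Winv cE.
  exact: extends_retime (time_change_sym (dilation_time_change c1)) dom' pp'.
Qed.

End Dilation.

Theorem lemma4 (R : realType) (n qbar : nat) (P : problem_data R n qbar)
    (ups : R) (l : \bar R)
    (hP : standing_assumptions P) (hups : 0 < ups) (hl : (1 <= l)%E) :
  set_bij (maximal_solution_pairs (target P ups l))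
          (maximal_solution_pairs (nominal P ups l))
          (W ups l)
  /\
  forall p, maximal_solution_pairs (target P ups l) p ->
    hdom (W ups l p).1 =
      [set r | exists2 r', hdilation ups l (init_gain p.1) r = Some r'
                         & hdom p.1 r'].
Proof.
have [g [h GP]] := gain_primitives_exist hups hl.
split; first exact: W_bij GP.
move=> p _; apply/seteqP; split => r; rewrite /hdom /W /=.
- by case: (hdilation _ _ _ r) => //= r' pr'; exists r'.
- by move=> [r' -> pr'].
Qed.
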